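(* Let $(M,\mathcal{T},\Phi)$ be a weighted triangulated surface and $\alpha\in\mathbb{R}$. If there is a circle packing metric $r$ satisfying $R_{\alpha,i}\ge 0$ for all $i\in V$, and $$-\sum_{(e,v)\in Lk(I)}(\pi-\Phi(e))+2\pi\chi(F_I)<0\qquad\text{for all } I \text{ with } \emptyset\subsetneqq I\subsetneqq V,$$ then there exists a non-negative constant $\alpha$-curvature metric $r^*$ on $(M,\mathcal{T},\Phi)$, i.e. a circle packing metric $r^*$ and a constant $c\ge0$ with $R_{\alpha,i}(r^* )=c$ for all $i\in V$.
   Context: $M$ is a closed surface with a triangulation $\mathcal{T}=\{V,E,F\}$ (vertices, edges, faces), $V=\{1,\dots,N\}$, and $\Phi:E\to[0,\pi/2]$ is a weight function; the triple $(M,\mathcal{T},\Phi)$ is called a weighted triangulated surface. $\chi$ denotes Euler characteristic. A circle packing metric is a map $r:V\to(0,+\infty)$. It determines edge lengths $l_{ij}=\sqrt{r_i^2+r_j^2+2r_ir_j\cos\Phi_{ij}}$; for each face $\{ijk\}$ the lengths satisfy the triangle inequalities, so the face is realized as a Euclidean triangle, and $\theta_i^{jk}$ denotes its inner angle at $i$. Put $K_i=2\pi-\sum_{\{ijk\}\in F}\theta_i^{jk}$ (sum over all faces containing $i$) and define the $\alpha$-curvature $R_{\alpha,i}=K_i/r_i^\alpha$. For a nonempty proper subset $I\subset V$, $F_I$ is the subcomplex of $\mathcal{T}$ consisting of all cells whose vertices are all in $I$, and $Lk(I)$ is the set of pairs $(e,v)$ of an edge $e$ and a vertex $v$ such that the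 end points of $e$ are not in $I$, $v\in I$, and $e$ and $v$ form a triangle of $\mathcal{T}$. *)

(* Defs.v *)
From HB Require Import structures.
From mathcomp Require Import all_boot all_order all_algebra.
From mathcomp Require Import reals exp trigo.

Set Implicit Arguments.
Unset Strict Implicit.
Unset Printing Implicit Defensive.

Import Order.TTheory GRing.Theory Num.Theory.
Local Open Scope ring_scope.
Local Open Scope set_scope.

(** Triangulated closed surfaces are finite simplicial complexes on the vertex
    set ['I_N], given by their faces; the surface condition is that the link of
    every vertex is a circle. *)

Definition link N (F : {set {set 'I_N}}) (i : 'I_N) : {set {set 'I_N}} :=
  [set f :\ i | f in F & i \in f].

(* [L] is the edge set of the simple closed polygon visiting [s] cyclically.
   The bound on the size excludes the degenerate 2-gon, whose two sides would
   be the same set of vertices. *)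
Definition is_polygon N (L : {set {set 'I_N}}) : Prop :=
  exists s : seq 'I_N,
    [/\ uniq s, (2 < size s)%N & L = [set [set x; next s x] | x in s]].

Record triangulation (N : nat) := Triangulation {
  faces : {set {set 'I_N}};
  card_face : forall f, f \in faces -> #|f| = 3%N;
  link_polygon : forall i, is_polygon (link faces i)
}.

Definition edges N (T : triangulation N) : {set {set 'I_N}} :=
  [set e : {set 'I_N} | (#|e| == 2%N) && [exists f in faces T, e \subset f]].

Definition cells N (T : triangulation N) : {set {set 'I_N}} :=
  [set [set i] | i : 'I_N] :|: edges T :|: faces T.

Definition subcomplex N (T : triangulation N) (I : {set 'I_N}) :
    {set {set 'I_N}} :=
  [set s in cells T | s \subset I].

(* A cell with [k] vertices has dimension [k - 1]. *)
Definition euler_char N (C : {set {set 'I_N}}) : int :=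
  \sum_(s in C) (-1) ^+ #|s|.-1.

Definition Lk N (T : triangulation N) (I : {set 'I_N}) :
    {set {set 'I_N} * 'I_N} :=
  [set p | [&& p.1 \in edges T, [disjoint p.1 & I], p.2 \in I
             & p.2 |: p.1 \in faces T]].

(* Only the values of a weight on the edges matter. *)
Definition weight_function (R : realType) N (T : triangulation N)
    (Phi : {set 'I_N} -> R) : Prop :=
  forall e, e \in edges T -> 0 <= Phi e <= pi / 2.

Definition circle_packing_metric (R : realType) N (r : 'I_N -> R) : Prop :=
  forall i, 0 < r i.

Section Curvature.
Variables (R : realType) (N : nat) (T : triangulation N).
Variables (Phi : {set 'I_N} -> R) (r : 'I_N -> R).

Definition edge_length (i j : 'I_N) : R :=
  Num.sqrt (r i ^+ 2 + r j ^+ 2 + 2 * r i * r j * cos (Phi [set i; j])).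

(* Law of cosines: the angle at [i] of the Euclidean triangle with the three
   given side lengths. *)
Definition angle (i j k : 'I_N) : R :=
  acos ((edge_length i j ^+ 2 + edge_length i k ^+ 2 - edge_length j k ^+ 2)
        / (2 * edge_length i j * edge_length i k)).

(* The condition [j < k] makes every face containing [i] count once. *)
Definition curvature (i : 'I_N) : R :=
  2 * pi
  - \sum_(j < N) \sum_(k < N | (j < k)%N && ([set i; j; k] \in faces T))
      angle i j k.

Definition alpha_curvature (alpha : R) (i : 'I_N) : R :=
  curvature i / (r i `^ alpha).

End Curvature.

(* Main.v *)
Require Import Defs.
From HB Require Import structures.
From mathcomp Require Import all_boot all_order all_algebra.
From mathcomp Require Import fingroup perm reals exp trigo.
From mathcomp Require Import zify ring lra.
From mathcomp Require all_classical all_reals all_analysis.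

(** Write [u = ln r] and [S] for the total curvature, which does not depend on
    [r] and is nonnegative by assumption. A zero of the field
    [G_i(u) = K_i - S r_i^alpha / sum_j r_j^alpha] is a metric of constant
    [alpha]-curvature. On a large cube [-L, L]^N, Kuhn's cubical form of
    Sperner's lemma yields a point [u] where [G_i > 0] forces [u_i = -L] and
    [G_i < 0] forces [u_i = L]. The [G_i] add up to zero, so if they do not all
    vanish then both bounds are attained, and between them lies a gap of length
    at least [2L/N] in the values of [u]. Let [J] be the set of vertices below
    the gap. Their radii are negligible against the other ones, so the sum of
    the [K_j] over [J] exceeds [- sum_(Lk J) (pi - Phi e) + 2 pi chi(F_J)], which
    is negative, only by a small error. Hence [G_j < 0] for some [j] in [J],
    although [u_j < L]. *)

Set Implicit Arguments.
Unset Strict Implicit.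
Unset Printing Implicit Defensive.

Import Order.TTheory GRing.Theory Num.Theory.
Local Open Scope ring_scope.
Local Open Scope set_scope.

(** * Angles of a circle packing triangle *)

Section Angles.
Variable R : realType.
Implicit Types p q s x y z a b c d e t : R.

(* 16 times the squared area of the triangle with sides [p], [q], [s]. *)
Local Notation heron p q s :=
  (2 * p ^+ 2 * q ^+ 2 + 2 * q ^+ 2 * s ^+ 2 + 2 * s ^+ 2 * p ^+ 2
   - p ^+ 4 - q ^+ 4 - s ^+ 4).

Lemma law_of_cosines_sin2 p q s : 0 < p -> 0 < q ->
  1 - ((p ^+ 2 + q ^+ 2 - s ^+ 2) / (2 * p * q)) ^+ 2 =
  heron p q s / (2 * p * q) ^+ 2.
Proof. by move=> p0 q0; field; rewrite !lt0r_neq0. Qed.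

(** Positive area replaces the triangle inequalities: it makes the squared sine of the angle
    positive. *)
Lemma law_of_cosines_bounds p q s : 0 < p -> 0 < q -> 0 < heron p q s ->
  -1 < (p ^+ 2 + q ^+ 2 - s ^+ 2) / (2 * p * q) < 1.
Proof.
move=> p0 q0 H; rewrite -ltr_norml -(@ltr_pXn2r _ 2) ?nnegrE //.
rewrite real_normK ?num_real // expr1n -subr_gt0 law_of_cosines_sin2 //.
by rewrite divr_gt0 // exprn_gt0 // !mulr_gt0.
Qed.

Lemma sin_law_of_cosines p q s : 0 < p -> 0 < q -> 0 < heron p q s ->
  sin (acos ((p ^+ 2 + q ^+ 2 - s ^+ 2) / (2 * p * q))) =
  Num.sqrt (heron p q s) / (2 * p * q).
Proof.
move=> p0 q0 H; have /andP[h1 h2] := law_of_cosines_bounds p0 q0 H.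
rewrite sin_acos ?ltW // law_of_cosines_sin2 //.
rewrite sqrtrM ?ltW // sqrtrV ?exprn_ge0 ?mulr_ge0 ?ltW //.
by rewrite sqrtr_sqr ger0_norm // !mulr_ge0 // ltW.
Qed.

(** The addition formulas, with sines expressed through the area, give [cos (A + B) = - cos C] and
    [sin (A + B) > 0]. The latter places [A + B] in [[0, pi]], where the cosine determines the
    angle. *)
Lemma triangle_angle_sum p q s :
  0 < p -> 0 < q -> 0 < s -> 0 < heron p q s ->
  acos ((p ^+ 2 + q ^+ 2 - s ^+ 2) / (2 * p * q)) +
  acos ((p ^+ 2 + s ^+ 2 - q ^+ 2) / (2 * p * s)) +
  acos ((q ^+ 2 + s ^+ 2 - p ^+ 2) / (2 * q * s)) = pi.
Proof.
move=> p0 q0 s0 H.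
have H' : heron p s q = heron p q s by ring.
have H1 : 0 < heron p s q by rewrite H'.
have /andP[A1 A2] := law_of_cosines_bounds p0 q0 H.
have /andP[B1 B2] := law_of_cosines_bounds p0 s0 H1.
have sA := sin_law_of_cosines p0 q0 H; have sB := sin_law_of_cosines p0 s0 H1.
have A3 : 0 <= acos ((p ^+ 2 + q ^+ 2 - s ^+ 2) / (2 * p * q)) <= pi.
  by rewrite acos_ge0 ?acos_lepi ?ltW.
have B3 : 0 <= acos ((p ^+ 2 + s ^+ 2 - q ^+ 2) / (2 * p * s)) <= pi.
  by rewrite acos_ge0 ?acos_lepi ?ltW.
have cA : cos (acos ((p ^+ 2 + q ^+ 2 - s ^+ 2) / (2 * p * q))) =
  (p ^+ 2 + q ^+ 2 - s ^+ 2) / (2 * p * q) by rewrite acosK // in_itv /= !ltW.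
have cB : cos (acos ((p ^+ 2 + s ^+ 2 - q ^+ 2) / (2 * p * s))) =
  (p ^+ 2 + s ^+ 2 - q ^+ 2) / (2 * p * s) by rewrite acosK // in_itv /= !ltW.
set A := acos _ in sA A3 cA *; set B := acos _ in sB B3 cB *.
have sq : Num.sqrt (heron p q s) ^+ 2 = heron p q s by rewrite sqr_sqrtr // ltW.
have sq0 : 0 < Num.sqrt (heron p q s) by rewrite sqrtr_gt0.
rewrite H' in sB.
set d := Num.sqrt _ in sA sB sq sq0.
have nz : [&& p != 0, q != 0 & s != 0] by rewrite !lt0r_neq0.
have/and3P[pz qz sz] := nz.
have cAB : cos (A + B) = - ((q ^+ 2 + s ^+ 2 - p ^+ 2) / (2 * q * s)).
  rewrite cosD cA cB sA sB.
  have -> : d / (2 * p * q) * (d / (2 * p * s)) = d ^+ 2 / (4 * p ^+ 2 * q * s).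
    by field; rewrite pz qz sz.
  by rewrite sq; field; rewrite pz qz sz.
have sAB : 0 < sin (A + B).
  rewrite sinD cA cB sA sB.
  have -> : d / (2 * p * q) * ((p ^+ 2 + s ^+ 2 - q ^+ 2) / (2 * p * s)) +
    (p ^+ 2 + q ^+ 2 - s ^+ 2) / (2 * p * q) * (d / (2 * p * s)) = d / (2 * q * s).
    by field; rewrite pz qz sz.
  by rewrite divr_gt0 // !mulr_gt0.
move: A3 B3 => /andP[A3 A4] /andP[B3 B4].
have lt : A + B <= pi.
  rewrite leNgt; apply/negP => gt.
  have : 0 <= sin (A + B - pi) by apply: sin_ge0_pi; apply/andP; split; lra.
  by rewrite sinB sinpi cospi; lra.
(* The argument of the third [acos] is rewritten as [cos (pi - (A + B))]. *)
rewrite -(opprK (_ / _)) -cAB -cosDpi -cosN opprD.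
rewrite -(cosD2pi (- (A + B) - pi)).
rewrite (_ : _ + pi *+ 2 = pi - (A + B)); last by rewrite mulr2n; ring.
by rewrite cosK ?in_itv /=; [ring | apply/andP; split; lra].
Qed.

Lemma ler_cos : {in `[0, pi]%R &, {mono @cos R : x y /~ y <= x}}.
Proof.
move=> x y xI yI; by rewrite !leNgt (ltr_cos yI xI).
Qed.

(** If [t <= B - e], then [cos t >= cos (B - e)], which is at least [cos B + (1 - cos e)]: in half
    angles this reads [2 sin (e/2) sin (B - e/2) >= 2 sin (e/2)^2]. Cosine estimates thus become
    angle estimates that are uniform in [B]. *)
Lemma cos_le_angle e t B : 0 <= e <= pi -> 0 <= t <= pi -> B <= pi ->
  cos t < cos B + (1 - cos e) -> B - e < t.
Proof.
move=> /andP[e0 e1] /andP[t0 t1] B1 h; rewrite ltNge; apply/negP=> le.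
have : cos (B - e) <= cos t by rewrite ler_cos ?in_itv /= ?t0 //; apply/andP; split; lra.
suff : cos B + (1 - cos e) <= cos (B - e) by lra.
have -> : cos (B - e) = cos ((B - e / 2) - e / 2) by congr cos; lra.
have -> : cos B = cos ((B - e / 2) + e / 2) by congr cos; lra.
have -> : cos e = cos (e / 2 + e / 2) by congr cos; lra.
rewrite cosB !cosD.
have s0 : 0 <= sin (e / 2) by apply: sin_ge0_pi; apply/andP; split; lra.
have sc := cos2Dsin2 (e / 2).
suff : sin (e / 2) <= sin (B - e / 2) by nra.
(* This holds because [e / 2 <= B - e / 2 <= pi - e / 2]. *)
have -> : sin (B - e / 2) = cos (B - e / 2 - pi / 2).
  by rewrite cosB cos_pihalf sin_pihalf mulr0 mulr1 add0r.
have -> : sin (e / 2) = cos (pi / 2 - e / 2).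
  by rewrite cosB cos_pihalf sin_pihalf mul0r mul1r add0r.
have [le0|gt0] := leP (B - e / 2) (pi / 2).
  by rewrite -(cosN (B - e / 2 - pi / 2)) ler_cos ?in_itv /=;
    first lra; apply/andP; split; lra.
by rewrite ler_cos ?in_itv /=; first lra; apply/andP; split; lra.
Qed.

End Angles.

(** * Triangles spanned by the centers of three circles *)

Section Packing.
Variable R : realType.
Implicit Types p q s x y z a b c d e t : R.

Local Notation heron p q s :=
  (2 * p ^+ 2 * q ^+ 2 + 2 * q ^+ 2 * s ^+ 2 + 2 * s ^+ 2 * p ^+ 2
   - p ^+ 4 - q ^+ 4 - s ^+ 4).

(** Here [x], [y], [z] are radii and [a], [b], [c] cosines of weights. As the cosines lie in
    [[0, 1]], the squared area expands into nonnegative terms. *)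
Lemma heron_packing_gt0 p q s x y z a b c :
  0 < x -> 0 < y -> 0 < z -> 0 <= a <= 1 -> 0 <= b <= 1 -> 0 <= c <= 1 ->
  p ^+ 2 = x ^+ 2 + y ^+ 2 + 2 * x * y * c ->
  q ^+ 2 = x ^+ 2 + z ^+ 2 + 2 * x * z * b ->
  s ^+ 2 = y ^+ 2 + z ^+ 2 + 2 * y * z * a -> 0 < heron p q s.
Proof.
move=> x0 y0 z0 /andP[a0 a1] /andP[b0 b1] /andP[c0 c1] p2 q2 s2.
have -> : heron p q s = 4 * ((x * z) ^+ 2 * (1 - b ^+ 2) +
    (x * y) ^+ 2 * (1 - c ^+ 2) + (y * z) ^+ 2 * (1 - a ^+ 2) +
    2 * (x * y * z) * (y * (b + c * a) + z * (c + a * b) + x * (b * c) + x * a)).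
  have -> : heron p q s = 2 * p ^+ 2 * q ^+ 2 + 2 * q ^+ 2 * s ^+ 2 +
    2 * s ^+ 2 * p ^+ 2 - (p ^+ 2) ^+ 2 - (q ^+ 2) ^+ 2 - (s ^+ 2) ^+ 2 by ring.
  by rewrite p2 q2 s2; ring.
have sq t : 0 <= t -> t <= 1 -> 0 <= 1 - t ^+ 2 by move=> *; nra.
have h1 : 0 <= (x * z) ^+ 2 * (1 - b ^+ 2) by rewrite mulr_ge0 ?sqr_ge0 ?sq.
have h2 : 0 <= (x * y) ^+ 2 * (1 - c ^+ 2) by rewrite mulr_ge0 ?sqr_ge0 ?sq.
have h3 : 0 <= 2 * (x * y * z) * (y * (b + c * a) + z * (c + a * b) + x * (b * c)).
  by rewrite !(mulr_ge0, addr_ge0) // ltW.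
(* These two terms cannot vanish together: the first is positive for [a = 0], the second
   otherwise. *)
suff : 0 < (y * z) ^+ 2 * (1 - a ^+ 2) + 2 * (x * y * z) * (x * a).
  by move=> *; rewrite mulr_gt0 //; lra.
have [->|an] := eqVneq a 0.
  by rewrite expr0n /= subr0 mulr1 !mulr0 addr0 exprn_gt0 ?mulr_gt0.
apply: ltr_wpDl; first by rewrite mulr_ge0 ?sqr_ge0 ?sq.
by rewrite !mulr_gt0 // lt0r an.
Qed.

(* With [x] much smaller than [y] and [z], the triangle looks from its first
   vertex like the one with sides [y] and [z] enclosing an angle of cosine
   [- a]. *)
Lemma cos_angle_small_vertex p q s x y z a b c d :
  0 < x -> 0 < y -> 0 < z -> 0 <= a <= 1 -> 0 <= b <= 1 -> 0 <= c <= 1 ->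
  0 < p -> 0 < q ->
  p ^+ 2 = x ^+ 2 + y ^+ 2 + 2 * x * y * c ->
  q ^+ 2 = x ^+ 2 + z ^+ 2 + 2 * x * z * b ->
  s ^+ 2 = y ^+ 2 + z ^+ 2 + 2 * y * z * a ->
  0 < d <= 1 -> x <= d * y -> x <= d * z ->
  (p ^+ 2 + q ^+ 2 - s ^+ 2) / (2 * p * q) <= - a + 6 * d.
Proof.
move=> x0 y0 z0 /andP[a0 a1] /andP[b0 b1] /andP[c0 c1] p0 q0 p2 q2 s2.
move=> /andP[d0 d1] xy xz.
have [x0' y0' z0' d0'] : [/\ 0 <= x, 0 <= y, 0 <= z & 0 <= d] by rewrite !ltW.
rewrite ler_pdivrMr ?mulr_gt0 // s2 p2 q2.
have yp : y <= p.
  rewrite -(@ler_pXn2r _ 2) ?nnegrE ?(ltW p0) ?(ltW q0) // p2.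
  have : 0 <= x * y * c by rewrite !mulr_ge0.
  by have := sqr_ge0 x; lra.
have zq : z <= q.
  rewrite -(@ler_pXn2r _ 2) ?nnegrE ?(ltW p0) ?(ltW q0) // q2.
  have : 0 <= x * z * b by rewrite !mulr_ge0.
  by have := sqr_ge0 x; lra.
have py : p <= (1 + d) * y.
  apply: (@le_trans _ _ (x + y)); last by lra.
  rewrite -(@ler_pXn2r _ 2) ?nnegrE ?addr_ge0 ?(ltW p0) ?(ltW q0) // p2.
  have : 0 <= x * y * (1 - c) by rewrite !mulr_ge0 ?subr_ge0.
  by lra.
have qz : q <= (1 + d) * z.
  apply: (@le_trans _ _ (x + z)); last by lra.
  rewrite -(@ler_pXn2r _ 2) ?nnegrE ?addr_ge0 ?(ltW p0) ?(ltW q0) // q2.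
  have : 0 <= x * z * (1 - b) by rewrite !mulr_ge0 ?subr_ge0.
  by lra.
have P1 : y * z <= p * q by apply: ler_pM => //; exact: ltW.
have P2 : p * q <= ((1 + d) * y) * ((1 + d) * z) by apply: ler_pM => //; exact: ltW.
have yz : 0 < y * z by rewrite mulr_gt0.
have n1 : x * x <= d * (y * z).
  have : x * x <= (d * y) * (d * z) by apply: ler_pM => //; exact: ltW.
  have : 0 <= (d * (1 - d)) * (y * z) by rewrite !mulr_ge0 ?subr_ge0.
  by lra.
have n2 : x * (y * c) <= d * (y * z).
  apply: (@le_trans _ _ ((d * z) * (y * 1))); last by lra.
  by apply: ler_pM => //; rewrite ?mulr_ge0 // ler_pM2l.
have n3 : x * (z * b) <= d * (y * z).
  apply: (@le_trans _ _ ((d * y) * (z * 1))); last by lra.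
  by apply: ler_pM => //; rewrite ?mulr_ge0 // ler_pM2l.
set w := y * z in P1 yz n1 n2 n3 *; set v := p * q in P1 P2.
have P2' : v <= w + 3 * (d * w).
  have : 0 <= (d * (1 - d)) * w by rewrite !mulr_ge0 ?subr_ge0.
  by rewrite /w in P2 *; lra.
have Q1 : a * v <= a * w + 3 * (d * w).
  apply: (@le_trans _ _ (a * (w + 3 * (d * w)))); first by rewrite ler_wpM2l.
  have : 0 <= (1 - a) * (d * w) by rewrite !mulr_ge0 ?subr_ge0.
  by lra.
have Q2 : d * w <= d * v by rewrite ler_pM2l.
(* Half the numerator is [x^2 + x y c + x z b - a w]. Each of the three terms with [x] costs [d w],
   and passing from [a w] to [a v] costs [3 d w]; this is the constant 6. *)
have -> : (- a + 6 * d) * (2 * p * q) = 12 * (d * v) - 2 * (a * v) by rewrite /v; ring.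
suff : x * x + x * (y * c) + x * (z * b) - a * w <= 6 * (d * v) - a * v.
  by rewrite /w; lra.
by lra.
Qed.

(** Counterpart for a vertex whose radius [z] is large beside the other two: the sides at it are
    close to [z], the opposite side is negligible, and the angle closes up. *)
Lemma cos_angle_large_vertex p q s x y z a b c d :
  0 < x -> 0 < y -> 0 < z -> 0 <= a <= 1 -> 0 <= b <= 1 -> 0 <= c <= 1 ->
  0 < p -> 0 < q ->
  p ^+ 2 = z ^+ 2 + x ^+ 2 + 2 * z * x * b ->
  q ^+ 2 = z ^+ 2 + y ^+ 2 + 2 * z * y * a ->
  s ^+ 2 = x ^+ 2 + y ^+ 2 + 2 * x * y * c ->
  0 < d <= 1 -> x <= d * z -> y <= d * z ->
  1 - 4 * d <= (p ^+ 2 + q ^+ 2 - s ^+ 2) / (2 * p * q).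
Proof.
move=> x0 y0 z0 /andP[a0 a1] /andP[b0 b1] /andP[c0 c1] p0 q0 p2 q2 s2.
move=> /andP[d0 d1] xz yz.
have [x0' y0' z0' d0'] : [/\ 0 <= x, 0 <= y, 0 <= z & 0 <= d] by rewrite !ltW.
rewrite ler_pdivlMr ?mulr_gt0 // s2 p2 q2.
have pz : p <= (1 + d) * z.
  apply: (@le_trans _ _ (z + x)); last by lra.
  rewrite -(@ler_pXn2r _ 2) ?nnegrE ?addr_ge0 ?(ltW p0) ?(ltW q0) // p2.
  have : 0 <= z * x * (1 - b) by rewrite !mulr_ge0 ?subr_ge0.
  by lra.
have qz : q <= (1 + d) * z.
  apply: (@le_trans _ _ (z + y)); last by lra.
  rewrite -(@ler_pXn2r _ 2) ?nnegrE ?addr_ge0 ?(ltW p0) ?(ltW q0) // q2.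
  have : 0 <= z * y * (1 - a) by rewrite !mulr_ge0 ?subr_ge0.
  by lra.
have P2 : p * q <= ((1 + d) * z) * ((1 + d) * z) by apply: ler_pM => //; exact: ltW.
have zz : 0 < z * z by rewrite mulr_gt0.
have n1 : x * (y * c) <= d * (z * z).
  have : x * (y * c) <= (d * z) * (z * 1).
    apply: ler_pM; rewrite ?mulr_ge0 ?(ltW x0) ?(ltW y0) //.
    apply: ler_pM; rewrite ?(ltW y0) //.
    by apply: (le_trans yz); rewrite ler_piMl // ltW.
  by lra.
have n2 : 0 <= z * x * b by rewrite !mulr_ge0.
have n3 : 0 <= z * y * a by rewrite !mulr_ge0.
suff : (1 - 4 * d) * (p * q) <= (1 - d) * (z * z) by lra.
have w1 : 0 <= (1 - d) * (z * z) by rewrite !mulr_ge0 ?subr_ge0.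
(* When [1 - 4 * d] is nonpositive the claim is a comparison of signs; otherwise [p * q] may be
   replaced by its upper bound. *)
have [dle|dgt] := leP (1 - 4 * d) 0.
  apply: le_trans w1; rewrite -oppr_ge0 -mulNr mulr_ge0 ?mulr_ge0 ?(ltW p0) ?(ltW q0) //.
  by lra.
apply: (@le_trans _ _ ((1 - 4 * d) * (((1 + d) * z) * ((1 + d) * z)))).
  by rewrite ler_pM2l.
have : 0 <= (z * z) * (d * (1 - d)) by rewrite !mulr_ge0 ?subr_ge0.
have : 0 <= (z * z) * (d * d) by rewrite !mulr_ge0.
have : 0 <= (z * z) * (d * d * d) by rewrite !mulr_ge0.
have : 0 <= (z * z) * d by rewrite !mulr_ge0.
by move=> *; lra.
Qed.

Variables (N : nat) (Phi : {set 'I_N} -> R).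
Implicit Types (r : 'I_N -> R) (i j k : 'I_N).

Lemma edge_lengthC r i j : edge_length Phi r i j = edge_length Phi r j i.
Proof. by rewrite /edge_length setUC; congr Num.sqrt; ring. Qed.

Lemma angleC r i j k : angle Phi r i j k = angle Phi r i k j.
Proof.
rewrite /angle (edge_lengthC r j k) (addrC (edge_length Phi r i j ^+ 2)).
by congr (acos (_ / _)); ring.
Qed.

Definition acute (e : {set 'I_N}) := 0 <= Phi e <= pi / 2.

Lemma cos_acute (e : {set 'I_N}) : acute e -> 0 <= cos (Phi e) <= 1.
Proof.
move=> /andP[e0 e1]; rewrite cos_le1 andbT cos_ge0_pihalf //.
by apply/andP; split=> //; have := @pi_ge0 R; lra.
Qed.

Lemma edge_length_sq_gt0 r i j : circle_packing_metric r -> acute [set i; j] ->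
  0 < r i ^+ 2 + r j ^+ 2 + 2 * r i * r j * cos (Phi [set i; j]).
Proof.
move=> r0 /cos_acute /andP[c0 _].
rewrite ltr_wpDr ?mulr_ge0 ?(ltW (r0 _)) //.
by rewrite addr_gt0 // exprn_gt0.
Qed.

Lemma edge_length_gt0 r i j : circle_packing_metric r -> acute [set i; j] ->
  0 < edge_length Phi r i j.
Proof. by move=> r0 h; rewrite sqrtr_gt0 edge_length_sq_gt0. Qed.

Lemma sqr_edge_length r i j : circle_packing_metric r -> acute [set i; j] ->
  edge_length Phi r i j ^+ 2 =
  r i ^+ 2 + r j ^+ 2 + 2 * r i * r j * cos (Phi [set i; j]).
Proof. by move=> r0 h; rewrite sqr_sqrtr // ltW ?edge_length_sq_gt0. Qed.

Section Face.
Variables (i j k : 'I_N).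
Hypotheses (ij : acute [set i; j]) (ik : acute [set i; k]) (jk : acute [set j; k]).

(** The strict bounds give the range of the angle and also keep the argument of [acos] where it is
    continuous. *)
Lemma angle_cos_bounds r : circle_packing_metric r ->
  -1 < (edge_length Phi r i j ^+ 2 + edge_length Phi r i k ^+ 2
        - edge_length Phi r j k ^+ 2)
        / (2 * edge_length Phi r i j * edge_length Phi r i k) < 1.
Proof.
move=> r0; apply: law_of_cosines_bounds; rewrite ?edge_length_gt0 //.
apply: (heron_packing_gt0 (r0 i) (r0 j) (r0 k) (cos_acute jk) (cos_acute ik)
  (cos_acute ij)); exact: sqr_edge_length.
Qed.

Lemma angle_bounds r : circle_packing_metric r -> 0 <= angle Phi r i j k <= pi.
Proof.
move=> r0; have /andP[h1 h2] := angle_cos_bounds r0.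
by rewrite acos_ge0 ?acos_lepi ?ltW.
Qed.

Lemma face_angle_sum r : circle_packing_metric r ->
  angle Phi r i j k + angle Phi r j i k + angle Phi r k i j = pi.
Proof.
move=> r0; rewrite /angle (edge_lengthC r j i) (edge_lengthC r k i) (edge_lengthC r k j).
apply: triangle_angle_sum; rewrite ?edge_length_gt0 //.
apply: (heron_packing_gt0 (r0 i) (r0 j) (r0 k) (cos_acute jk) (cos_acute ik)
  (cos_acute ij)); exact: sqr_edge_length.
Qed.

(** As [r i] tends to zero, the sides at [i] tend to [r j] and [r k], and the angle to [pi - Phi
    [set j; k]]. The condition linking [d] and [e] makes this quantitative, uniformly in the
    weights. *)
Lemma angle_small_vertex r d e : circle_packing_metric r -> 0 < d <= 1 ->
  0 <= e <= pi -> 6 * d < 1 - cos e -> r i <= d * r j -> r i <= d * r k ->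
  pi - Phi [set j; k] - e < angle Phi r i j k.
Proof.
move=> r0 d01 e0 de rij rik; apply: cos_le_angle => //.
- exact: angle_bounds.
- by have /andP[? _] := jk; lra.
have /andP[h1 h2] := angle_cos_bounds r0.
rewrite acosK ?in_itv /= ?ltW //.
have -> : cos (pi - Phi [set j; k]) = - cos (Phi [set j; k]).
  by rewrite addrC cosDpi cosN.
apply: le_lt_trans (_ : _ <= - cos (Phi [set j; k]) + 6 * d) _; last by lra.
exact: (cos_angle_small_vertex (r0 i) (r0 j) (r0 k) (cos_acute jk)
  (cos_acute ik) (cos_acute ij) (edge_length_gt0 _ _) (edge_length_gt0 _ _)
  (sqr_edge_length _ _) (sqr_edge_length _ _) (sqr_edge_length _ _) d01).
Qed.

Lemma angle_large_vertex r d e : circle_packing_metric r -> 0 < d <= 1 ->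
  0 <= e <= pi -> 4 * d <= 1 - cos e -> r j <= d * r i -> r k <= d * r i ->
  angle Phi r i j k <= e.
Proof.
move=> r0 d01 e0 de rij rik.
rewrite -ler_cos ?in_itv /= ?angle_bounds //.
have /andP[h1 h2] := angle_cos_bounds r0.
rewrite acosK ?in_itv /= ?(ltW h1) ?(ltW h2) //.
apply: (@le_trans _ _ (1 - 4 * d)); first lra.
exact: (cos_angle_large_vertex (r0 j) (r0 k) (r0 i) (cos_acute ik) (cos_acute ij)
  (cos_acute jk) (edge_length_gt0 _ _) (edge_length_gt0 _ _)
  (sqr_edge_length _ _) (sqr_edge_length _ _) (sqr_edge_length _ _) d01).
Qed.

End Face.
End Packing.

(** * Sums over the corners of the triangulation *)

Section Combinatorics.
Variables (N : nat) (T : triangulation N).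
Implicit Types (i j k : 'I_N) (J e f : {set 'I_N}).
Local Notation triple := ('I_N * 'I_N * 'I_N)%type.

(** Faces with an ordering of their vertices. The set is stable under permuting the positions, so
    sums over it can be symmetrized; each face occurs six times. *)
Definition triples : {set triple} :=
  [set p | [set p.1.1; p.1.2; p.2] \in faces T].

Lemma mem_triples i j k : ((i, j, k) \in triples) = ([set i; j; k] \in faces T).
Proof. by rewrite inE. Qed.

Lemma triples_swap12 i j k : ((j, i, k) \in triples) = ((i, j, k) \in triples).
Proof. by rewrite !mem_triples (setUC [set j]). Qed.

Lemma triples_swap23 i j k : ((i, k, j) \in triples) = ((i, j, k) \in triples).
Proof. by rewrite !mem_triples setUAC. Qed.

Lemma triples_uniq i j k : (i, j, k) \in triples -> [&& i != j, i != k & j != k].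
Proof.
rewrite mem_triples => /card_face; rewrite setUC cardsU1 cards2 !inE.
by rewrite (eq_sym i k) (eq_sym j k); do !case: eqP.
Qed.

Lemma edge_of_triple i j k : (i, j, k) \in triples -> [set j; k] \in edges T.
Proof.
move=> t; have /and3P[_ _ jk] := triples_uniq t.
rewrite inE cards2 jk /=; apply/existsP; exists [set i; j; k].
by rewrite -mem_triples t /= -setUA subsetUr.
Qed.

Lemma card_triples_of_face f : #|f| = 3%N ->
  (#|[set p : triple | [set p.1.1; p.1.2; p.2] == f]| <= 6)%N.
Proof.
move=> f3; have <- : #|[set t : 3.-tuple 'I_N | all (mem f) t & uniq t]| = 6%N.
  by rewrite card_uniq_tuples f3.
pose h (p : triple) := [tuple p.1.1; p.1.2; p.2].
rewrite -(@card_in_imset _ _ h); last first.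
  by move=> [[i j] k] [[i' j'] k'] _ _ /(congr1 val) [-> -> ->].
apply/subset_leq_card/subsetP => t /imsetP[[[i j] k]]; rewrite inE /= => /eqP e ->.
rewrite inE /= -!e !inE !eqxx !orbT /= andbT.
move: f3; rewrite -e setUC cardsU1 cards2 !inE.
by rewrite (eq_sym i k) (eq_sym j k); do !case: eqP.
Qed.

Lemma card_triples_inside J :
  (#|[set p in triples | [&& p.1.1 \in J, p.1.2 \in J & p.2 \in J]]| <=
   6 * #|[set f in faces T | f \subset J]|)%N.
Proof.
pose h (p : triple) := [set p.1.1; p.1.2; p.2].
rewrite -sum1_card (partition_big h (mem [set f in faces T | f \subset J])) /=.
  rewrite mulnC -sum_nat_const; apply: leq_sum => f; rewrite inE => /andP[fT _].
  rewrite sum1_card; apply: leq_trans (card_triples_of_face (card_face fT)).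
  by apply/subset_leq_card/subsetP => p; rewrite !inE => /andP[_].
move=> [[i j] k]; rewrite !inE /= => /and4P[-> iJ jJ kJ] /=.
by rewrite !subUset !sub1set iJ jJ kJ.
Qed.

(** The link of [i] is a polygon through [j]; the successor and the predecessor of [j] complete the
    edge to two faces. They differ because a polygon has more than two vertices. *)
Lemma edge_in_two_faces i j : [set i; j] \in edges T -> exists k k',
  [/\ k != k', (i, j, k) \in triples & (i, j, k') \in triples].
Proof.
rewrite inE cards2 eqSS eqb1 => /andP[ij /existsP[f /andP[fT]]].
rewrite subUset !sub1set => /andP[fi fj].
have [s [us s2 eL]] := link_polygon T i.
have js : j \in s.
  have : f :\ i \in link (faces T) i by apply/imsetP; exists f; rewrite ?inE ?fT.
  rewrite eL => /imsetP[x xs efi].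
  have : j \in f :\ i by rewrite !inE fj andbT eq_sym.
  by rewrite efi !inE => /orP[] /eqP -> //; rewrite mem_next.
have face x : x \in s -> (i, x, next s x) \in triples.
  move=> xs; have : [set x; next s x] \in link (faces T) i.
    by rewrite eL; apply/imsetP; exists x.
  move=> /imsetP[g]; rewrite inE => /andP[gT gi] e.
  by rewrite mem_triples -setUA e setD1K.
exists (next s j), (prev s j); split; last 2 first.
- exact: face.
- have := face (prev s j); rewrite next_prev // mem_prev => /(_ js).
  by rewrite triples_swap23.
(* Rotating [s] to start at [j] makes the successor the second entry and the predecessor the last
   one. *)
case/rot_to: (js) => m s' es.
rewrite -(next_rot m) // -(prev_rot m) // es.
have : uniq (j :: s') by rewrite -es rot_uniq.
have : (2 < size (j :: s'))%N by rewrite -es size_rot.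
have last_at p y : j \notin p -> prev_at j j y p = last y p.
  elim: p y => [|y' p IH] y; first by rewrite /= eqxx.
  by rewrite inE negb_or /= => /andP[/negbTE -> /IH].
case: s' {es} => [|a [|b s']] //= _ /and3P[]; rewrite eqxx !inE !negb_or.
move=> /and3P[/negbTE -> /negbTE -> js'] an _; apply/negP => /eqP eab.
by move: an; rewrite eab last_at // -negb_or -in_cons mem_last.
Qed.

Definition edges_inside J := [set e in edges T | e \subset J].
Definition faces_inside J := [set f in faces T | f \subset J].

(** An edge inside [J] has two orientations and at least two adjacent faces, hence at least four
    triples. *)
Lemma card_edges_inside J : (4 * #|edges_inside J| <=
  #|[set p in triples | (p.1.1 \in J) && (p.1.2 \in J)]|)%N.
Proof.
pose h (p : triple) := [set p.1.1; p.1.2].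
rewrite -[leqRHS]sum1_card (partition_big h (mem (edges_inside J))) /=; last first.
  move=> [[i j] k]; rewrite inE => /and3P[t iJ jJ].
  have eT : [set i; j] \in edges T.
    by apply: (@edge_of_triple k); rewrite triples_swap12 triples_swap23.
  have : h (i, j, k) \in edges_inside J by rewrite in_set eT /= subUset !sub1set iJ.
  by [].
rewrite mulnC -sum_nat_const; apply: leq_sum => e; rewrite inE => /andP[eT].
have : #|e| == 2%N by move: eT; rewrite inE => /andP[].
move=> /cards2P[i [j [ij def_e]]]; rewrite {}def_e in eT *.
rewrite subUset !sub1set => /andP[iJ jJ].
have [k [k' [kk t t']]] := edge_in_two_faces eT.
rewrite sum1_card -[4%N]/(size [:: (i, j, k); (i, j, k'); (j, i, k); (j, i, k')]).
rewrite -(card_uniqP _); last first.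
  by rewrite /= !inE !xpair_eqE !eqxx (eq_sym j i) !(negPf ij) !(negPf kk).
apply/subset_leq_card/subsetP => p; rewrite !inE.
have u := t; have u' := t'; rewrite -triples_swap12 in u; rewrite -triples_swap12 in u'.
rewrite !mem_triples in t t' u u'.
by case/or4P => /eqP ->; rewrite unfold_in !in_set /= ?t ?t' ?u ?u' iJ jJ /h /=
  ?eqxx // setUC.
Qed.

Lemma euler_char_subcomplex J : euler_char (subcomplex T J) =
  #|J|%:Z - #|edges_inside J|%:Z + #|faces_inside J|%:Z.
Proof.
pose V := [set [set i] | i in J].
have -> : subcomplex T J = (V :|: edges_inside J) :|: faces_inside J.
  apply/setP=> s; rewrite !inE; case: (boolP (s \subset J)) => sJ; rewrite ?andbT ?andbF.
    congr (_ || _ || _); apply/imsetP/imsetP => -[i iJ es]; exists i => //.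
    by rewrite -sub1set -es.
  rewrite !orbF; apply/esym/negbTE; apply: contra sJ => /imsetP[i iJ ->].
  by rewrite sub1set.
have cV s : s \in V -> #|s| = 1%N by move=> /imsetP[i _ ->]; rewrite cards1.
have cE s : s \in edges_inside J -> #|s| = 2%N.
  by rewrite !inE => /andP[/andP[/eqP]].
have cF s : s \in faces_inside J -> #|s| = 3%N.
  by rewrite !inE => /andP[/card_face].
have dVE : [disjoint V & edges_inside J].
  by apply/pred0P => s /=; apply/negP => /andP[/cV + /cE]; move=> ->.
have dF : [disjoint V :|: edges_inside J & faces_inside J].
  apply/pred0P => s /=; apply/negP; rewrite inE => /andP[/orP[/cV|/cE] + /cF].
    by move=> ->.
  by move=> ->.
have bU (A B : {set {set 'I_N}}) (h : {set 'I_N} -> int) : [disjoint A & B] ->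
    \sum_(s in A :|: B) h s = \sum_(s in A) h s + \sum_(s in B) h s.
  by move=> dAB; rewrite -bigU //=; apply: eq_bigl => s; rewrite !inE.
rewrite /euler_char !bU //; congr (_ + _ + _).
- rewrite (eq_bigr (fun=> 1)) => [|s /cV -> //].
  by rewrite sumr_const card_imset ?natz //; apply: set1_inj.
- rewrite (eq_bigr (fun=> -1)) => [|s /cE -> //].
  by rewrite sumr_const mulNrn natz.
rewrite (eq_bigr (fun=> 1)) => [|s /cF -> //].
by rewrite sumr_const natz.
Qed.

(** * Symmetrization of sums over ordered faces *)

Section TripleSums.
Variable R : realType.
Implicit Types (h g : 'I_N -> 'I_N -> 'I_N -> R).

Definition tsum h : R := \sum_(p in triples) h p.1.1 p.1.2 p.2.

Lemma tsum_swap12 h : tsum (fun i j k => h j i k) = tsum h.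
Proof.
pose f (p : triple) := (p.1.2, p.1.1, p.2).
have fK : involutive f by case=> -[].
rewrite [RHS]/tsum (reindex_inj (inv_inj fK)) /=.
by apply: eq_bigl => -[[i j] k]; rewrite triples_swap12.
Qed.

Lemma tsum_swap23 h : tsum (fun i j k => h i k j) = tsum h.
Proof.
pose f (p : triple) := (p.1.1, p.2, p.1.2).
have fK : involutive f by case=> -[].
rewrite [RHS]/tsum (reindex_inj (inv_inj fK)) /=.
by apply: eq_bigl => -[[i j] k]; rewrite triples_swap23.
Qed.

Lemma tsumD h g : tsum (fun i j k => h i j k + g i j k) = tsum h + tsum g.
Proof. exact: big_split. Qed.

Lemma ler_tsum h g :
  (forall i j k, (i, j, k) \in triples -> h i j k <= g i j k) -> tsum h <= tsum g.
Proof. by move=> hg; apply: ler_sum => -[[i j] k]; apply: hg. Qed.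

Lemma tsum_sym h :
  tsum (fun i j k => h i j k + h j i k + h k i j) = 3 * tsum h.
Proof.
rewrite (tsumD (fun i j k => h i j k + h j i k) (fun i j k => h k i j)).
rewrite (tsumD h (fun i j k => h j i k)) (tsum_swap12 h).
rewrite (tsum_swap23 (fun i j k => h j i k)) (tsum_swap12 h).
by ring.
Qed.

(** Only the sums over the three corners of a face have to be compared. This suits angles, whose sum
    is known for a whole face and not at a single corner. *)
Lemma ler_tsum_sym h g : (forall i j k, (i, j, k) \in triples ->
    h i j k + h j i k + h k i j <= g i j k + g j i k + g k i j) ->
  tsum h <= tsum g.
Proof. by move=> /ler_tsum; rewrite !tsum_sym ler_pM2l. Qed.

Lemma tsum_nat (P : 'I_N -> 'I_N -> 'I_N -> bool) :
  tsum (fun i j k => (P i j k)%:R) =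
  #|[set p in triples | P p.1.1 p.1.2 p.2]|%:R.
Proof.
rewrite -sum1_card natr_sum /tsum [in LHS]big_mkcond [RHS]big_mkcond /=.
apply: eq_bigr => p _; rewrite [in RHS]in_set.
by case: (p \in triples) => //=; case: (P _ _ _).
Qed.

(** An edge [{j, k}] and a vertex [v] paired in [Lk T J] come from the two triples [(v, j, k)] and
    [(v, k, j)], whence the factor 2. *)
Lemma Lk_sum (w : {set 'I_N} -> R) J : (forall e, e \in edges T -> 0 <= w e) ->
  2 * (\sum_(p in Lk T J) w p.1) <= tsum (fun i j k =>
    w [set j; k] *+ [&& i \in J, j \notin J & k \notin J]).
Proof.
move=> w0; pose h (p : triple) := ([set p.1.2; p.2], p.1.1).
rewrite /tsum (eq_bigr (fun p : triple =>
  if [&& p.1.1 \in J, p.1.2 \notin J & p.2 \notin J] then w [set p.1.2; p.2] else 0)) => [|p _]; last by rewrite mulrb.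
rewrite -big_mkcondr (partition_big h (mem (Lk T J))) /=; last first.
  move=> [[i j] k] /= /andP[t /and3P[iJ jJ kJ]].
  have : h (i, j, k) \in Lk T J; last by [].
  rewrite in_set /h /= (edge_of_triple t) iJ /=.
  apply/andP; split; last by rewrite setUA -mem_triples.
  apply/pred0P => x /=; rewrite !inE.
  by case: eqP => [->|_]; [rewrite (negPf jJ)|case: eqP => [->|]; rewrite ?(negPf kJ)].
rewrite mulr_sumr; apply: ler_sum => -[e v] /=.
rewrite inE /= => /and4P[eT eJ vJ veT].
rewrite (eq_bigr (fun=> w e)) => [|p /andP[_ /eqP [<- _]] //].
rewrite sumr_const -[leRHS]mulr_natl ler_wpM2r ?w0 // ler_nat.
have : #|e| == 2%N by move: eT; rewrite inE => /andP[].
move=> /cards2P[j [k [jk def_e]]]; rewrite {}def_e in eT eJ veT *.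
rewrite -[2%N]/(size [:: (v, j, k); (v, k, j)]) -(card_uniqP _); last first.
  by rewrite /= !inE !xpair_eqE !eqxx (negPf jk).
have jJ : j \notin J by move: eJ => /pred0P/(_ j); rewrite /= !inE eqxx /= => ->.
have kJ : k \notin J by move: eJ => /pred0P/(_ k); rewrite /= !inE eqxx orbT /= => ->.
have t : (v, j, k) \in triples by rewrite mem_triples -setUA.
have t' : (v, k, j) \in triples by rewrite triples_swap23.
apply/subset_leq_card/subsetP => p; rewrite !inE => /orP[] /eqP ->;
  by rewrite unfold_in /= vJ jJ kJ /h /= ?t ?t' ?(setUC [set k]) eqxx.
Qed.

End TripleSums.
End Combinatorics.

(** Pigeonhole principle: the [n + 1] nested sublevel sets at heights [- L + k h], with
    [h = 2 L / n], cannot all be distinct, as the first is nonempty. Where two consecutive ones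
    agree, no value lies in between. *)
Lemma gap_set (R : realType) n (u : 'I_n -> R) (L : R) (i0 i1 : 'I_n) :
  0 < L -> u i0 = - L -> u i1 = L -> exists J : {set 'I_n},
  [/\ J != set0, J != [set: 'I_n], forall i, i \in J -> u i < L &
   forall i j, i \in J -> j \notin J -> u i + 2 * L / n%:R <= u j].
Proof.
move=> L0 u0 u1; pose h := 2 * L / n%:R.
have n0 : (0 < n)%N by apply: leq_ltn_trans (ltn_ord i0).
have nh : n%:R * h = 2 * L by rewrite /h mulrC divfK // pnatr_eq0 -lt0n.
have h0 : 0 < h by rewrite divr_gt0 ?ltr0n // mulr_gt0.
pose S k := [set i | u i <= - L + k%:R * h].
have SS k : S k \subset S k.+1.
  by apply/subsetP => i; rewrite !inE -natr1; lra.
have [/existsP[k /eqP Sk]|none] := boolP [exists k : 'I_n, S k == S k.+1]; last first.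
  have card_S k : (k <= n)%N -> (k < #|S k|)%N.
    elim: k => [_|k IH kn].
      by rewrite card_gt0; apply/set0Pn; exists i0; rewrite inE u0 mul0r addr0.
    apply: leq_ltn_trans (IH (ltnW kn)) _; apply: proper_card.
    rewrite properEneq SS andbT; move: none; rewrite negb_exists => /forallP.
    by move/(_ (Ordinal kn)).
  by have := card_S n (leqnn _); rewrite ltnNge (leq_trans (max_card _)) // card_ord.
have kh : k%:R * h + h <= 2 * L.
  rewrite -nh -[X in _ + X]mul1r -mulrDl ler_pM2r // natr1 ler_nat; exact: ltn_ord.
have lt i : i \in S k -> u i < L by rewrite inE; lra.
exists (S k); split=> //.
- apply/set0Pn; exists i0; rewrite inE u0 lerDl mulr_ge0 //; exact: ltW.
- by apply/negP => /eqP/setP/(_ i1); rewrite [RHS]inE => /lt; rewrite u1 ltxx.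
(* For [j], membership is tested in [S k.+1] instead of [S k], which gains the step [h]. *)
- by move=> i j; rewrite {2}Sk !inE -natr1 -/h -ltNge; lra.
Qed.

(** * Curvature summed over sets of vertices *)

Section CurvatureSums.
Variables (R : realType) (N : nat) (T : triangulation N) (Phi : {set 'I_N} -> R).
Implicit Types (r : 'I_N -> R) (i j k : 'I_N) (J : {set 'I_N}).

(** The vertices of a face are distinct, so the diagonal does not occur, and symmetry of [a]
    identifies the pairs with [j < k] and with [k < j]. *)
Lemma sum_ordered_pairs i (a : 'I_N -> 'I_N -> R) : (forall j k, a j k = a k j) ->
  \sum_j \sum_(k | (i, j, k) \in triples T) a j k =
  2 * \sum_(j < N) \sum_(k < N | (j < k)%N && ([set i; j; k] \in faces T)) a j k.
Proof.
move=> aC; pose b j k : R := if (j < k)%N && ((i, j, k) \in triples T) then a j k else 0.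
have -> : \sum_(j < N) \sum_(k < N | (j < k)%N && ([set i; j; k] \in faces T)) a j k
          = \sum_j \sum_k b j k.
  apply: eq_bigr => j _; rewrite big_mkcond; apply: eq_bigr => k _.
  by rewrite -mem_triples.
rewrite mulr_natl mulr2n [X in _ = X + _]exchange_big -big_split.
apply: eq_bigr => j _; rewrite big_mkcond -big_split; apply: eq_bigr => k _ /=.
rewrite /b triples_swap23.
case: (boolP (_ \in _)) => [t|_]; rewrite ?andbF ?addr0 // !andbT.
have /and3P[_ _ jk] := triples_uniq t; rewrite -val_eqE in jk.
by case: ltngtP jk => //= _ _; rewrite ?addr0 ?add0r.
Qed.

Lemma sum_curvature r J :
  \sum_(i in J) curvature T Phi r i = 2 * pi * #|J|%:R
  - tsum T (fun i j k => angle Phi r i j k *+ (i \in J)) / 2.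
Proof.
rewrite /curvature big_split /= sumr_const mulr_natr; congr (_ + _).
rewrite sumrN; congr (- _); apply: canRL (mulfK _) _; first by rewrite pnatr_eq0.
rewrite /tsum mulrC mulr_sumr.
under eq_bigr => i _ do rewrite -(sum_ordered_pairs i (fun j k => angleC Phi r i j k)).
rewrite big_mkcond /=.
under eq_bigr => i _.
  rewrite (_ : (if _ then _ else _) = \sum_j \sum_(k | (i, j, k) \in triples T)
    angle Phi r i j k *+ (i \in J)); first over.
  by case: (i \in J); last by rewrite big1 // => j _; rewrite big1.
by rewrite pair_big_dep /= pair_big_dep; apply: eq_bigl => -[[i j] k].
Qed.

Hypothesis hPhi : weight_function T Phi.

Lemma triple_acute i j k : (i, j, k) \in triples T ->
  [/\ acute Phi [set i; j], acute Phi [set i; k] & acute Phi [set j; k]].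
Proof.
move=> t; split; apply: hPhi; last exact: edge_of_triple t.
  by apply: (@edge_of_triple _ _ k); rewrite triples_swap12 triples_swap23.
by apply: (@edge_of_triple _ _ j); rewrite triples_swap12.
Qed.

(** Discrete Gauss-Bonnet theorem. After symmetrization every angle counts as [pi / 3], its mean
    over the face, so the total does not involve [r]. *)
Lemma total_curvature r : circle_packing_metric r ->
  \sum_i curvature T Phi r i = 2 * pi * N%:R - pi / 6 * #|triples T|%:R.
Proof.
move=> r0; have := sum_curvature r [set: 'I_N].
rewrite cardsT card_ord (eq_bigl predT) => [->|i]; last by rewrite inE.
congr (_ - _).
have -> : tsum T (fun i j k => angle Phi r i j k *+ (i \in [set: 'I_N])) =
          tsum T (fun _ _ _ => pi / 3).
  apply/eqP; rewrite eq_le; apply/andP; split; apply: ler_tsum_sym => i j k t;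
  have [ij ik jk] := triple_acute t; have := face_angle_sum ij ik jk r0;
  rewrite !inE !mulr1n; lra.
by rewrite /tsum sumr_const -mulr_natr; field.
Qed.

(** Faces are sorted by their number of vertices in [J]. With three, the angles at [J] add up to
    [pi]; with two, the third angle is at most [e]; with one, the angle there is at least
    [pi - Phi - e] for the opposite edge. Counting edges through faces turns the multiples of [pi]
    into the Euler characteristic. *)
Lemma sum_curvature_le r J (d e : R) : circle_packing_metric r ->
  0 < d <= 1 -> 0 <= e <= pi -> 6 * d < 1 - cos e ->
  (forall i j, i \in J -> j \notin J -> r i <= d * r j) ->
  \sum_(i in J) curvature T Phi r i <=
  - (\sum_(p in Lk T J) (pi - Phi p.1))
  + 2 * pi * (euler_char (subcomplex T J))%:~R + e * #|triples T|%:R.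
Proof.
move=> r0 d01 e01 de small.
have e0 : 0 <= e by case/andP: e01.
have de' : 4 * d <= 1 - cos e by case/andP: d01; lra.
(* [g3], [g2] and [g1] single out these three kinds of faces. In a face of the second kind, each of
   the two corners in [J] receives [pi / 2]. *)
pose g3 i j k : R := [&& i \in J, j \in J & k \in J]%:R.
pose g2 i j k : R := [&& i \in J, j \in J & k \notin J]%:R.
pose g1 i j k : R := (pi - Phi [set j; k]) *+ [&& i \in J, j \notin J & k \notin J].
have lower : tsum T (fun i j k => pi / 3 * g3 i j k + pi / 2 * (g2 i j k + g2 i k j)
    + g1 i j k - e) <= tsum T (fun i j k => angle Phi r i j k *+ (i \in J)).
  apply: ler_tsum_sym => i j k t; have [ij ik jk] := triple_acute t.
  have sum_pi := face_angle_sum ij ik jk r0.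
  have ji : acute Phi [set j; i] by rewrite setUC.
  have ki : acute Phi [set k; i] by rewrite setUC.
  have kj : acute Phi [set k; j] by rewrite setUC.
  rewrite /g1 /g2 /g3.
  case: (boolP (i \in J)) => iJ; case: (boolP (j \in J)) => jJ;
  case: (boolP (k \in J)) => kJ; rewrite /= ?mulr0n ?mulr1n; try lra.
  - have := angle_large_vertex ki kj ij r0 d01 e01 de'
      (small _ _ iJ kJ) (small _ _ jJ kJ).
    lra.
  - have := angle_large_vertex ji jk ik r0 d01 e01 de'
      (small _ _ iJ jJ) (small _ _ kJ jJ).
    lra.
  - have := angle_small_vertex ij ik jk r0 d01 e01 de (small _ _ iJ jJ) (small _ _ iJ kJ).
    lra.
  - have := angle_large_vertex ij ik jk r0 d01 e01 de'
      (small _ _ jJ iJ) (small _ _ kJ iJ).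
    lra.
  - have := angle_small_vertex ji jk ik r0 d01 e01 de (small _ _ jJ iJ) (small _ _ jJ kJ).
    lra.
  - have := angle_small_vertex ki kj ij r0 d01 e01 de (small _ _ kJ iJ) (small _ _ kJ jJ).
    lra.
have split_sum : tsum T (fun i j k => pi / 3 * g3 i j k + pi / 2 * (g2 i j k + g2 i k j)
    + g1 i j k - e) =
    pi / 3 * tsum T g3 + pi * tsum T g2 + tsum T g1 - e * #|triples T|%:R.
  have -> : pi * tsum T g2 = pi / 2 * tsum T g2 + pi / 2 * tsum T (fun i j k => g2 i k j).
    by rewrite (tsum_swap23 T g2); lra.
  have -> : e * #|triples T|%:R = \sum_(p in triples T) e.
    by rewrite sumr_const mulr_natr.
  rewrite /tsum !mulr_sumr -!big_split -sumrB /=.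
  by apply: eq_bigr => p _; ring.
have pi0 : 0 < pi :> R := pi_gt0 R.
have lk : 2 * (\sum_(p in Lk T J) (pi - Phi p.1)) <= tsum T g1.
  apply: (Lk_sum (w := fun e => pi - Phi e)) => e' /hPhi /andP[_ h]; lra.
have t3 : tsum T g3 <= 6 * #|faces_inside T J|%:R.
  by rewrite tsum_nat -natrM ler_nat card_triples_inside.
have t2 : 4 * #|edges_inside T J|%:R <= tsum T g3 + tsum T g2.
  have -> : tsum T g3 + tsum T g2 = tsum T (fun i j k => ((i \in J) && (j \in J))%:R).
    rewrite -tsumD; apply: eq_bigr => p _; rewrite /g3 /g2.
    by do 3!case: (_ \in J); rewrite /= ?addr0 ?add0r.
  by rewrite (@tsum_nat N T R (fun i j k => (i \in J) && (j \in J))) -natrM ler_nat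
    card_edges_inside.
rewrite sum_curvature euler_char_subcomplex.
rewrite !(intrD, rmorphN) /= -!pmulrn.
move: lower; rewrite split_sum => lower.
move: lower lk t3 t2; set T3 := tsum T g3; set T2 := tsum T g2; set T1 := tsum T g1.
set A := tsum T _; set B := \sum_(p in _) _; set V : R := #|J|%:R.
set E : R := #|edges_inside T J|%:R; set F : R := #|faces_inside T J|%:R.
set M : R := #|triples T|%:R => lower lk t3 t2.
(* The edge count bounds [T2] below by [4 * E - T3]. This leaves [T3] with a positive coefficient in
   the upper bound, where [T3 <= 6 * F] applies. *)
have q3 : 0 <= pi * (6 * F - T3) by rewrite mulr_ge0 ?subr_ge0 // ltW.
have q2 : 0 <= pi * (T3 + T2 - 4 * E) by rewrite mulr_ge0 ?subr_ge0 // ltW.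
have eM : 0 <= e * M by rewrite mulr_ge0.
lra.
Qed.
End CurvatureSums.

(** * Sperner's lemma for a cube *)

Module Kuhn.
Local Open Scope nat_scope.

(** The points moved by [f] come in pairs, of which the enumeration order puts one member into [A]
    and the other into [B]. *)
Lemma odd_card_involution (T : finType) (D : {set T}) (f : T -> T) :
    (forall x, x \in D -> f x \in D) -> (forall x, x \in D -> f (f x) = x) ->
  odd #|D| = odd #|[set x in D | f x == x]|.
Proof.
move=> fD fK.
pose A := [set x in D | enum_rank x < enum_rank (f x)].
pose B := [set x in D | enum_rank (f x) < enum_rank x].
have cAB : #|A| = #|B|.
  have -> : B = f @: A.
    apply/setP=> x; rewrite inE; apply/andP/imsetP => [[xD lt]|[y + ->]].
      by exists (f x); rewrite ?inE ?fD ?fK.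
    by rewrite inE => /andP[yD lt]; rewrite fD ?fK.
  rewrite card_in_imset // => x y; rewrite !inE => /andP[xD _] /andP[yD _] e.
  by rewrite -(fK x) // e fK.
set X := [set x in D | _].
have -> : D = X :|: (A :|: B).
  apply/setP=> x; rewrite !inE; case: (x \in D) => //=.
  case: ltngtP => //=; rewrite ?orbT // => /val_inj /enum_rank_inj <-.
  by rewrite eqxx.
rewrite !cardsU cAB.
have -> : A :&: B = set0.
  by apply/setP=> x; rewrite !inE; case: ltngtP; rewrite ?andbF.
have -> : X :&: (A :|: B) = set0.
  apply/setP=> x; rewrite !inE; case: (x \in D) => //=.
  by case: eqP => //= ->; rewrite ltnn.
by rewrite cards0 !subn0 oddD addnn odd_double addbF.
Qed.

(** Both sides have the same sum over all [i], so the inequalities are equalities. *)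
Lemma perm_ge_id n (s : {perm 'I_n}) : (forall i : 'I_n, i <= s i) -> s = 1%g.
Proof.
move=> h; have : \sum_(i < n) i == \sum_(i < n) s i.
  by rewrite (reindex_perm s).
have := (leqif_sum (fun (i : 'I_n) (_ : true) => leqif_eq (h i))).
move=> -[_ ->] /forallP /= e; apply/permP=> i; rewrite perm1.
by apply/val_inj/esym/eqP/e.
Qed.

Lemma val_ord_pred n (i : 'I_n.+1) :
  ord_pred i = (if i == ord0 then n else i.-1) :> nat.
Proof.
rewrite -val_eqE /=; case: i => -[|i] ii //=; first by rewrite modn_small.
by rewrite modnDr modn_small // ltnW.
Qed.

Lemma val_ordS n (i : 'I_n.+1) :
  ordS i = (if i == ord_max then 0 else i.+1) :> nat.
Proof.
rewrite -val_eqE /=; case: i => i ii /=; case: eqP => [->|ne].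
  by rewrite modnn.
by rewrite modn_small //; lia.
Qed.

Lemma ord_pred0 n : ord_pred ord0 = ord_max :> 'I_n.+1.
Proof. by apply: ord_inj; rewrite val_ord_pred. Qed.

Lemma ordS_max n : ordS ord_max = ord0 :> 'I_n.+1.
Proof. by apply: ord_inj; rewrite val_ordS eqxx. Qed.

Section Kuhn.
Variables (n m : nat).
Local Notation pt := {ffun 'I_n.+1 -> nat}.
Local Notation cell := ({ffun 'I_n.+1 -> 'I_m.+1} * {perm 'I_n.+1})%type.

(* The simplices of Kuhn's triangulation of the cube: the vertex number [k] of
   [(b, s)] is obtained from the corner [b] by increasing the coordinates in
   the first [k] positions of the order given by [s]. *)
Definition kuhn_vertex (c : cell) (k : nat) : pt :=
  [ffun i => c.1 i + (c.2 i < k)].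

(* Exchange of the vertex [k] for the one on the other side of the opposite
   facet; a facet on the boundary of the cube is left fixed. *)
Definition pivot (x : cell * 'I_n.+2) : cell * 'I_n.+2 :=
  let: (b, s, k) := x in
  if k == ord0 then
    if b ((s^-1)%g ord0) == ord_max then x else
    ([ffun i => inord (b i + (s i == ord0))],
     (s * perm (@ord_pred_inj _))%g, ord_max)
  else if k == ord_max then
    if b ((s^-1)%g ord_max) == ord0 then x else
    ([ffun i => inord (b i - (s i == ord_max))],
     (s * perm (@ordS_inj _))%g, ord0)
  else (b, (s * tperm (inord k.-1) (inord k))%g, k).

(** The moves at the two ends undo each other: one shifts the order cyclically and raises the base
    corner, the other reverts this. An inner move is an adjacent transposition, hence its own
    inverse. *)
Lemma pivotK : involutive pivot.
Proof.
move=> [[b s] k] /=; case: eqP => [->|/eqP k0] /=.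
  case: eqP => [e|/eqP ne] /=; first by rewrite e eqxx.
  have e1 : ((s * perm (@ord_pred_inj _))^-1)%g ord_max = (s^-1)%g ord0.
    apply: (@perm_inj _ (s * perm (@ord_pred_inj _))%g).
    by rewrite permKV permM permKV permE ord_pred0.
  (* Away from the upper boundary the raised coordinate stays in range, so [inord] does not fall
     back to its default. *)
  have bl : b ((s^-1)%g ord0) < m.
    by move: ne; rewrite -val_eqE /= => ne; have := ltn_ord (b ((s^-1)%g ord0)); lia.
  rewrite e1 !ffunE permKV eqxx addn1 -val_eqE /= inordK ?ltnS //=.
  congr (_, _, _).
    apply/ffunP=> i; rewrite !ffunE; apply: ord_inj.
    have -> : ((s * perm (@ord_pred_inj _))%g i == ord_max) = (s i == ord0).
      by rewrite permM permE -ord_pred0 (inj_eq (@ord_pred_inj _)).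
    case: (altP (s i =P ord0)) => [e|_]; last by rewrite addn0 subn0 !inord_val.
    have {e} -> : i = (s^-1)%g ord0 by rewrite -e permK.
    rewrite [in inord (_ - _)]inordK; last lia.
    by rewrite addnK inord_val.
  rewrite -mulgA -[RHS]mulg1; congr (_ * _)%g; apply/permP=> i.
  by rewrite permM !permE ord_predK.
case: eqP => [->|/eqP kn] /=.
  case: eqP => [e|/eqP ne] /=; first by rewrite eqxx e eqxx.
  have e1 : ((s * perm (@ordS_inj _))^-1)%g ord0 = (s^-1)%g ord_max.
    apply: (@perm_inj _ (s * perm (@ordS_inj _))%g).
    by rewrite permKV permM permKV permE ordS_max.
  have bl : 0 < b ((s^-1)%g ord_max) by rewrite lt0n.
  have bm : b ((s^-1)%g ord_max) <= m by rewrite -ltnS.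
  rewrite e1 !ffunE permKV eqxx subn1 -val_eqE /= inordK; last lia.
  rewrite ifN; last lia.
  congr (_, _, _).
    apply/ffunP=> i; rewrite !ffunE; apply: ord_inj.
    have -> : ((s * perm (@ordS_inj _))%g i == ord0) = (s i == ord_max).
      by rewrite permM permE -ordS_max (inj_eq (@ordS_inj _)).
    case: (altP (s i =P ord_max)) => [e|_]; last by rewrite subn0 addn0 !inord_val.
    have {e} -> : i = (s^-1)%g ord_max by rewrite -e permK.
    rewrite [in inord (_ + _)]inordK; last lia.
    by rewrite subnK // inord_val.
  rewrite -mulgA -[RHS]mulg1; congr (_ * _)%g; apply/permP=> i.
  by rewrite permM !permE ordSK.
by rewrite (negPf k0) (negPf kn) -mulgA tperm2 mulg1.
Qed.

Variable lab : pt -> option 'I_n.+1.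
(** Sperner boundary conditions. Prescribing the label on the lower faces outright pins down the one
    door on the boundary. *)
Hypothesis lab0 : forall (v : pt) (i : 'I_n.+1), v i = 0 ->
  (forall j : 'I_n.+1, j < i -> v j != 0) -> lab v = Some i.
Hypothesis labm : forall (v : pt) (i : 'I_n.+1), v i = m.+1 -> lab v != Some i.

(** The facet opposite the vertex [x.2] has all labels but [None]. Having [n + 1] vertices, it bears
    each of them once. *)
Definition door (x : cell * 'I_n.+2) : bool :=
  [set lab (kuhn_vertex x.1 j) | j : 'I_n.+2 in [set~ x.2]] == [set~ None].

(** Vertex numbers are natural numbers here, so that they can be shifted by one when [pivot]
    renumbers the vertices. *)
Lemma doorP (x : cell * 'I_n.+2) : reflect
  [/\ forall i, exists2 j : nat, j < n.+2 /\ j <> x.2 :> nat &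
        lab (kuhn_vertex x.1 j) = Some i &
      forall j : nat, j < n.+2 -> j <> x.2 :> nat -> lab (kuhn_vertex x.1 j) <> None]
  (door x).
Proof.
apply: (iffP eqP) => [/setP e|[h1 h2]].
  split=> [i|j jn jx lN].
    have := e (Some i); rewrite !inE /= => /imsetP[j]; rewrite !inE => jx ->.
    by exists j => //; split=> // /val_inj/eqP; apply/negP.
  have := e None; rewrite !inE eqxx /= => /negP; apply.
  apply/imsetP; exists (Ordinal jn) => //; rewrite !inE -val_eqE /=.
  exact/eqP.
apply/setP=> -[i|]; rewrite !inE /=; apply/imsetP.
  have [j [jn jx] e] := h1 i; exists (Ordinal jn) => //.
  by rewrite !inE -val_eqE; apply/eqP.
move=> -[j]; rewrite !inE -val_eqE => /eqP jx e.
exact: (h2 j).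
Qed.

Lemma door_inj x : door x ->
  {in [set~ x.2] &, injective (fun j : 'I_n.+2 => lab (kuhn_vertex x.1 j))}.
Proof.
move=> /eqP e; apply/imset_injP; rewrite e !cardsC1 card_option !card_ord.
by [].
Qed.

(** [pivot] replaces one vertex and keeps the facet opposite to it, up to renumbering. *)
Lemma door_pivot x : door x -> door (pivot x).
Proof.
move: x => [[b s] k] /=; case: eqP => [->|/eqP k0] /=.
  case: eqP => [//|/eqP ne] /=.
  have bl : b ((s^-1)%g ord0) < m.
    by move: ne; rewrite -val_eqE /= => ne; have := ltn_ord (b ((s^-1)%g ord0)); lia.
  set b' := finfun _; set s' := (s * _)%g.
  have e j : j < n.+1 -> kuhn_vertex (b', s') j = kuhn_vertex (b, s) j.+1.
    move=> jn; apply/ffunP=> i; rewrite !ffunE /= permM permE val_ord_pred.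
    case: (altP (s i =P ord0)) => [e|].
      have {e} ei : i = (s^-1)%g ord0 by rewrite -e permK.
      by rewrite ei permKV inordK /=; lia.
    by rewrite -val_eqE /= => si; rewrite addn0 inordK //; lia.
  move=> /doorP[/= h1 h2]; apply/doorP; split=> [i|j jn jx] /=.
    have [[|j] [jn jx] l] := h1 i; first by [].
    by exists j; [split; lia | rewrite e].
  have jn' : j < n.+1 by move: jx => /=; lia.
  by rewrite e //; apply: h2.
case: eqP => [->|/eqP kn] /=.
  case: eqP => [//|/eqP ne] /=.
  have bl : 0 < b ((s^-1)%g ord_max) by rewrite lt0n.
  have bm : b ((s^-1)%g ord_max) <= m by rewrite -ltnS.
  set b' := finfun _; set s' := (s * _)%g.
  have e j : j < n.+1 -> kuhn_vertex (b', s') j.+1 = kuhn_vertex (b, s) j.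
    move=> jn; apply/ffunP=> i; rewrite !ffunE /= permM permE val_ordS.
    case: (altP (s i =P ord_max)) => [e|].
      have {e} ei : i = (s^-1)%g ord_max by rewrite -e permK.
      by rewrite ei permKV inordK /=; lia.
    by move=> si; rewrite subn0 inordK //; lia.
  move=> /doorP[/= h1 h2]; apply/doorP; split=> [i|[|j] jn jx] //=.
    have [j [jn jx] l] := h1 i; exists j.+1; [split; lia | rewrite e //; lia].
  by rewrite e; [apply: h2|]; lia.
set s' := (s * _)%g.
have k0' : (k : nat) <> 0 by move/eqP; apply/negP.
have kn' : (k : nat) <> n.+1 by move/eqP; apply/negP.
(* Exchanging the adjacent positions [k - 1] and [k] affects the vertex number [k] only. *)
have e (j : nat) : j <> k -> kuhn_vertex (b, s') j = kuhn_vertex (b, s) j.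
  move=> jk; apply/ffunP=> i; rewrite !ffunE /= permM.
  have kk := ltn_ord k.
  case: tpermP => [->|->|] //; rewrite !inordK; lia.
move=> /doorP[/= h1 h2]; apply/doorP; split=> [i|j jn jx] //=.
  by have [j [jn jx] l] := h1 i; exists j => //; rewrite e.
by rewrite e //; apply: h2.
Qed.

(** A door fixed by [pivot] lies on the boundary. An upper face lacks the label of its direction by
    [labm]; on a lower face, [lab0] forces the base corner to be the origin and the order to be the
    identity. *)
Lemma fixed_door :
  [set x | door x & pivot x == x] = [set ([ffun=> ord0], 1%g, ord_max)].
Proof.
apply/setP=> -[[b s] k]; rewrite !inE; apply/andP/eqP => [[dx]|[-> -> ->]].
- have /doorP[/= h1 h2] := dx.
  rewrite /pivot; case: (altP (k =P ord0)) => [k0|k0].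
    case: (altP (b ((s^-1)%g ord0) =P ord_max)) => [e _|_ /eqP e];
      last by have := congr1 (fun x => val x.2) e; rewrite k0.
    (* Every vertex other than number 0 has coordinate [m + 1] in the direction raised first. *)
    have [j [jn jx]] := h1 ((s^-1)%g ord0) => /eqP l.
    suff : lab (kuhn_vertex (b, s) j) != Some ((s^-1)%g ord0) by rewrite l.
    rewrite k0 /= in jx; apply: labm; rewrite ffunE /= permKV e /=; lia.
  case: (altP (k =P ord_max)) => [kn|kn]; last first.
    move=> /eqP [] /permP/(_ ((s^-1)%g (inord k.-1))).
    rewrite permM permKV tpermL => /(congr1 val) /=.
    have := ltn_ord k.
    by move: k0 kn; rewrite -!val_eqE /= => k0 kn kk; rewrite !inordK; lia.
  case: (altP (b ((s^-1)%g ord_max) =P ord0)) => [e _|_ /eqP e];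
      last by have := congr1 (fun x => val x.2) e; rewrite kn.
  (* All vertices of the facet vanish in the last direction, so [lab0] gives their labels: the
     vertex labelled [i] has its first zero at [i]. *)
  have key i : exists2 j : nat, j <= s i & kuhn_vertex (b, s) j i = 0 /\
      forall i' : 'I_n.+1, i' < i -> kuhn_vertex (b, s) j i' <> 0.
    have [j [jn jx] l] := h1 i.
    rewrite kn /= in jx.
    have zero : kuhn_vertex (b, s) j ((s^-1)%g ord_max) = 0.
      by rewrite ffunE /= permKV e /=; lia.
    have [i0 /eqP iz imin] : exists2 i0 : 'I_n.+1, kuhn_vertex (b, s) j i0 == 0 &
        forall i' : 'I_n.+1, i' < i0 -> kuhn_vertex (b, s) j i' != 0.
      case: (@arg_minnP _ ((s^-1)%g ord_max)
        (fun i0 => kuhn_vertex (b, s) j i0 == 0) (fun i => i : nat)).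
        by rewrite zero.
      move=> i0 iz imin; exists i0 => // i' lt; apply/negP=> /imin.
      by rewrite leqNgt lt.
    have := lab0 iz imin; rewrite l => -[ei]; subst i0; exists j.
      by move: iz; rewrite ffunE /=; lia.
    by split=> // i' /imin /eqP.
  have b0 i : b i = ord0.
    apply/eqP; have [j _ []] := key i.
    by rewrite ffunE /= => /eqP; rewrite addn_eq0 => /andP[].
  have -> : s = 1%g.
    apply: perm_ge_id => i.
    (* The vertex labelled [i''] has been raised in direction [i'] but not yet in direction
       [i'']. *)
    have mono (i' i'' : 'I_n.+1) : i' < i'' -> s i' < s i''.
      move=> lt; have [j js [_ /(_ _ lt)]] := key i''.
      by rewrite ffunE /= b0 /=; lia.
    have P q (qn : q < n.+1) : q <= s (Ordinal qn).
      elim: q qn => // q IH qn; apply: leq_ltn_trans (IH (ltnW qn)) _.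
      exact: mono.
    by case: i => i ii; apply: P.
  by rewrite kn; congr (_, _, _); apply/ffunP=> i; rewrite ffunE.
- split; last by rewrite /pivot /= invg1 perm1 ffunE !eqxx.
  have l (i : 'I_n.+1) : lab (kuhn_vertex ([ffun=> ord0], 1%g) i) = Some i.
    by apply: lab0 => [|j ji]; rewrite !ffunE /= perm1 add0n ?ltnn ?ji.
  apply/doorP; split=> [i|j jn jx] /=.
    by exists i => //; have := ltn_ord i; split; lia.
  by have jn' : j < n.+1 by [move: jx => /=; lia]; rewrite (l (Ordinal jn')).
Qed.

Lemma kuhn_sperner : exists b : 'I_n.+1 -> nat, (forall i, b i <= m) /\
  forall l, exists v : pt, lab v = l /\ forall i, b i <= v i <= (b i).+1.
Proof.
(* Pivoting pairs the doors except for one on the boundary. If no simplex had all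
   labels, then each simplex would have no door or two of them, opposite its two
   vertices of equal label. *)
have oddD : odd #|[set x | door x]|.
  rewrite (@odd_card_involution _ _ pivot); last first.
  - by move=> x _; apply: pivotK.
  - by move=> x; rewrite !inE; apply: door_pivot.
  suff -> : [set x in [set x | door x] | pivot x == x] =
            [set ([ffun=> ord0], 1%g, ord_max)] by rewrite cards1.
  by rewrite -fixed_door; apply/setP=> x; rewrite !inE.
case: (boolP [exists c : cell,
  [forall l, exists k : 'I_n.+2, lab (kuhn_vertex c k) == l]]).
  move=> /existsP[[b s] /forallP h]; exists (fun i => b i : nat).
  split=> [i|l]; first by rewrite -ltnS.
  have /existsP[k /eqP e] := h l; exists (kuhn_vertex (b, s) k); split=> // i.
  by rewrite ffunE /=; case: (_ < _); lia.
rewrite negb_exists => /forallP nf; exfalso; move: oddD; apply/negP.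
pose L (c : cell) (k : 'I_n.+2) := lab (kuhn_vertex c k).
(* The other vertex with the label of [x.2]. The default value does not occur for a door as long as
   no simplex has all labels. *)
pose partner (x : cell * 'I_n.+2) :=
  (x.1, odflt x.2 [pick k' | (k' != x.2) && (L x.1 k' == L x.1 x.2)]).
have partnerP x : door x -> exists k',
    [/\ partner x = (x.1, k'), k' != x.2 & L x.1 k' = L x.1 x.2].
  move=> dx; rewrite /partner; case: pickP => [k' /andP[h /eqP h'] | none].
    by exists k'.
  (* An unrepeated label of [x.2] must be [None], since the facet has all others; the simplex would
     then have all labels. *)
  exfalso; have := nf x.1; rewrite negb_forall => /existsP[l]; apply/negP.
  rewrite negbK; have /doorP[h1 h2] := dx; apply/existsP.
  case: l => [i|].
    by have [j [jn _] e] := h1 i; exists (Ordinal jn); rewrite e.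
  exists x.2; case E : (lab _) => [i|//]; have [j [jn jx] e] := h1 i.
  have := none (Ordinal jn); rewrite /L E e eqxx andbT -val_eqE /=.
  by move/negbFE/eqP.
have doorU c k k' : door (c, k) -> k' != k -> L c k' = L c k -> door (c, k').
  move=> /doorP[/= h1 h2] kk e; apply/doorP; split=> [i|j jn jx] /=.
    have [j [jn jx] ej] := h1 i; case: (altP (j =P k')) => [jk'|/eqP]; last first.
      by exists j.
    exists k; first by split=> // /val_inj/esym/eqP; apply/negP.
    by rewrite -/(L c k) -e -ej jk'.
  case: (altP (j =P k)) => [jk|/eqP nk]; last exact: h2.
  by rewrite jk -/(L c k) -e; apply: h2 => // /val_inj /eqP; apply/negP.
have doorp x : door x -> door (partner x).
  by move=> dx; have [k' [-> kk e]] := partnerP x dx; apply: doorU kk e; case: x dx.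
rewrite (@odd_card_involution _ _ partner).
- rewrite (_ : [set _ in _ | _] = set0) ?cards0 //.
  apply/setP=> -[c k]; rewrite !inE; case: (boolP (door _)) => //= dx.
  by have [k' [-> /= kk _]] := partnerP _ dx; apply/negP=> /eqP [] /eqP; apply/negP.
- by move=> x; rewrite !inE; apply: doorp.
move=> [c k]; rewrite inE => dx; have dp := doorp _ dx.
have [k' [pe /= kk e]] := partnerP _ dx; rewrite pe in dp *.
have [k'' [-> /= kk' e']] := partnerP _ dp; congr (_, _).
(* Otherwise [k'] and [k''] are two vertices of the facet opposite [k] with equal labels. *)
case: (altP (k'' =P k)) => // nk.
move/eqP: kk' => []; apply: (door_inj dx); rewrite /= ?inE //.
Qed.

End Kuhn.

End Kuhn.

(** * Existence *)

(* A module, because these imports shadow [set0] and [setT] of finite sets. *)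
Module Existence.
Import all_classical all_reals all_analysis numFieldNormedType.Exports Kuhn.
Local Open Scope classical_set_scope.

(** * From Sperner labels to a variational inequality on the cube *)

Section Complementarity.
Variables (R : realType) (n : nat) (L : R) (G : 'I_n.+1 -> 'rV[R]_n.+1 -> R).
Hypothesis L_gt0 : 0 < L.

Let pt m (v : {ffun 'I_n.+1 -> nat}) : 'rV[R]_n.+1 :=
  \row_i (- L + 2 * L * (v i)%:R / m.+1%:R).

(** The label is the first vanishing coordinate if there is one, else an index with [v i != m.+1]
    and [G i <= 0], else [None]. A cell with all labels provides one point for each [i] and, through
    [None], one point serving all [i]. *)
Lemma grid_complementarity m : exists b : 'I_n.+1 -> nat,
  (forall i, b i <= m)%N /\
  ((forall i, exists v : {ffun 'I_n.+1 -> nat}, (v i = 0%N \/ G i (pt m v) <= 0) /\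
    forall j, (b j <= v j <= (b j).+1)%N) /\
  exists v : {ffun 'I_n.+1 -> nat}, (forall i, v i = m.+1 \/ 0 < G i (pt m v)) /\
    forall j, (b j <= v j <= (b j).+1)%N).
Proof.
pose lab (v : {ffun 'I_n.+1 -> nat}) : option 'I_n.+1 :=
  if [pick i | (v i == 0) && [forall j : 'I_n.+1, (j < i) ==> (v j != 0)]]%N is Some i
  then Some i else [pick i | (v i != m.+1) && (G i (pt m v) <= 0)].
have lab0 (v : {ffun 'I_n.+1 -> nat}) (i : 'I_n.+1) : v i = 0%N ->
    (forall j : 'I_n.+1, (j < i)%N -> v j != 0%N) -> lab v = Some i.
  move=> vi vj; rewrite /lab; case: pickP => [i' /andP[/eqP vi' /forallP vj']|].
    congr Some; apply: val_inj; case: (ltngtP i' i) => //= lt.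
      by have := vj _ lt; rewrite vi'.
    by have /implyP/(_ lt) := vj' i; rewrite vi.
  move/(_ i); rewrite vi eqxx /= => /negP; case.
  by apply/forallP=> j; apply/implyP=> /vj.
have labm (v : {ffun 'I_n.+1 -> nat}) (i : 'I_n.+1) : v i = m.+1 -> lab v != Some i.
  move=> vi; apply/negP => /eqP; rewrite /lab.
  case: pickP => [i' /andP[/eqP vi' _] [e]|_]; first by rewrite e vi in vi'.
  by case: pickP => // i' /andP[/eqP vi' _] [e]; apply: vi'; rewrite e vi.
have [b [bm h]] := kuhn_sperner lab0 labm; exists b; split=> //; split=> [i|].
  have [v [lv vb]] := h (Some i); exists v; split=> //.
  move: lv; rewrite /lab; case: pickP => [i' /andP[/eqP vi' _] [<-]|_]; first by left.
  by case: pickP => // i' /andP[_ g] [<-]; right.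
have [v [lv vb]] := h None; exists v; split=> // i.
move: lv; rewrite /lab; case: pickP => // _; case: pickP => // /(_ i) e _.
by move/negbT: e; rewrite negb_and negbK -ltNge => /orP[/eqP|]; [left|right].
Qed.

(* Hartman and Stampacchia's theorem on variational inequalities: a continuous field
   on a cube has a zero up to the normal cone of the cube. *)
Lemma cube_complementarity : (forall i, continuous (G i)) ->
  exists u : 'rV[R]_n.+1, forall i, - L <= u ord0 i <= L /\
    ((0 < G i u -> u ord0 i = - L) /\ (G i u < 0 -> u ord0 i = L)).
Proof.
move=> Gc.
have /choice [b bP] := grid_complementarity.
pose X m := pt m [ffun i => b m i].
pose K := [set v : 'rV[R]_n.+1 | forall i, `[- L, L] (v ord0 i)].
have Kc : compact K.
  by apply: (@rV_compact R n.+1 (fun=> `[- L, L])) => i; apply: segment_compact.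
have KX m : K (X m).
  move=> i /=; rewrite in_itv /= mxE ffunE.
  have bl : (b m i)%:R / m.+1%:R <= 1 :> R.
    by rewrite ler_pdivrMr // mul1r ler_nat; have [/(_ i)] := bP m; lia.
  have b0 : 0 <= (b m i)%:R / m.+1%:R :> R by rewrite divr_ge0.
  rewrite -mulrA; set t := _ / _ in bl b0 *; clearbody t.
  have p1 : 0 <= L * t by rewrite mulr_ge0 // ltW.
  have p2 : 0 <= L * (1 - t) by rewrite mulr_ge0 ?subr_ge0 // ltW.
  apply/andP; split; lra.
(* By compactness the base corners of ever finer cells accumulate at some [u]. *)
have [u [Ku uc]] : K `&` cluster (X @ \oo) !=set0.
  by apply: Kc; exists 0%N => // m _; exact: KX.
(* Every neighbourhood of [u] contains all corners of some cell, hence the points that realize its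
   labels. *)
have key (Q : set 'rV[R]_n.+1) : nbhs u Q -> exists m,
  (forall i, exists v : {ffun 'I_n.+1 -> nat},
     Q (pt m v) /\ (v i = 0%N \/ G i (pt m v) <= 0)) /\
  exists v : {ffun 'I_n.+1 -> nat},
    Q (pt m v) /\ forall i, v i = m.+1 \/ 0 < G i (pt m v).
  move=> /nbhs_ballP[e /= e0 eQ].
  have e2 : 0 < e / 2 by rewrite divr_gt0.
  (* From [M] on, the mesh [2 L / (m + 1)] is below [e / 2]. *)
  pose M := Num.truncn (4 * L / e).
  have [|x [[m mM <-] xb]] :=
      uc (X @` [set m | (M <= m)%N]) (ball u (e / 2)) _ (nbhsx_ballx _ _ e2).
    by exists M => // m /= mM; exists m.
  have mesh : 2 * L / m.+1%:R < e / 2.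
    rewrite ltr_pdivrMr // mulrAC ltr_pdivlMr //.
    have : 4 * L / e < m.+1%:R.
      apply: lt_le_trans (truncnS_gt _) _.
      by rewrite ler_nat.
    by rewrite ltr_pdivrMr //; lra.
  have near (v : {ffun 'I_n.+1 -> nat}) :
      (forall j, b m j <= v j <= (b m j).+1)%N -> Q (pt m v).
    move=> vb; apply: eQ; split=> // i j; have [_ /(_ i j)] := xb.
    rewrite /ball /= (ord1 i) !mxE ffunE.
    have /andP[v1 v2] := vb j.
    have [->|->] : v j = b m j \/ v j = (b m j).+1 by lia.
      by move=> h; lra.
    have -> : u ord0 j - (- L + 2 * L * (b m j).+1%:R / m.+1%:R) =
        u ord0 j - (- L + 2 * L * (b m j)%:R / m.+1%:R) - 2 * L / m.+1%:R.
      by rewrite -(natr1 (b m j)) mulrDr mulr1 mulrDl; ring.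
    have : 0 < 2 * L / m.+1%:R by rewrite divr_gt0 ?mulr_gt0.
    set d := 2 * L / _ in mesh *; set a := u _ _ - _.
    by rewrite !ltr_norml => d0 /andP[h1 h2]; apply/andP; split; lra.
  have [_ [h1 [v [h2 h3]]]] := bP m; exists m; split.
    by move=> i; have [w [w1 w2]] := h1 i; exists w; split=> //; apply: near.
  by exists v; split=> //; apply: near.
exists u => i; split; first by have := Ku i; rewrite /= in_itv.
have /andP[uL uU] : - L <= u ord0 i <= L by have := Ku i; rewrite /= in_itv.
have ci : {for u, continuous (fun x : 'rV[R]_n.+1 => x ord0 i)}.
  by apply: coord_continuous.
split=> g.
  apply/eqP; rewrite eq_le uL andbT leNgt; apply/negP=> ul.
  (* If [u] were off this face, both conditions would hold near [u], against the point provided for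
     [i]. *)
  have [|m [h _]] := key [set x | 0 < G i x /\ - L < x ord0 i].
    apply: filterI; first exact: (Gc i u _ (lt_nbhsr g)).
    exact: (ci _ (lt_nbhsr ul)).
  have [v [[/= g1 g2] [e|]]] := h i; last by lra.
  by move: g2; rewrite mxE e mulr0 mul0r; lra.
apply/eqP; rewrite eq_le uU /= leNgt; apply/negP=> ul.
(* This time the point serving all indices gives the contradiction. *)
have [|m [_ [v [[/= g1 g2] h]]]] := key [set x | G i x < 0 /\ x ord0 i < L].
  apply: filterI; first exact: (Gc i u _ (lt_nbhsl g)).
  exact: (ci _ (lt_nbhsl ul)).
have [e|] := h i; last by lra.
by move: g2; rewrite mxE e mulfK //; lra.
Qed.
End Complementarity.

Local Close Scope classical_set_scope.

(** * Continuity of angles in logarithmic radii *)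

Section ContinuousAngle.
Variables (R : realType) (N : nat) (Phi : {set 'I_N} -> R) (i j k : 'I_N).
Hypotheses (ij : acute Phi [set i; j]) (ik : acute Phi [set i; k]).
Hypothesis jk : acute Phi [set j; k].

Lemma continuous_angle :
  continuous (fun u : 'rV[R]_N => angle Phi (fun i => expR (u ord0 i)) i j k).
Proof.
have sq (f : 'rV[R]_N -> R) : continuous f -> continuous (fun u => f u ^+ 2).
  by move=> fc u; exact: (cvgM (fc u) (fc u)).
pose l i j (u : 'rV[R]_N) := edge_length Phi (fun i => expR (u ord0 i)) i j.
have lc i' j' : continuous (l i' j').
  have ec (v : 'I_N) : continuous (fun u : 'rV[R]_N => expR (u ord0 v)).
    move=> u; apply: (@continuous_comp _ _ _ (fun u : 'rV[R]_N => u ord0 v) expR).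
      exact: coord_continuous.
    exact: continuous_expR.
  rewrite /l /edge_length => u.
  apply: (@continuous_comp _ _ _ (fun u : 'rV[R]_N =>
    expR (u ord0 i') ^+ 2 + expR (u ord0 j') ^+ 2 +
    2 * expR (u ord0 i') * expR (u ord0 j') * cos (Phi [set i'; j'])) Num.sqrt);
    last exact: sqrt_continuous.
  exact: (cvgD (cvgD (sq _ (ec i') u) (sq _ (ec j') u))
    (cvgM (cvgM (cvgM (cvg_cst (2 : R)) (ec i' u)) (ec j' u)) (cvg_cst _))).
move=> u; have r0 : circle_packing_metric (fun i => expR (u ord0 i)).
  by move=> v; exact: expR_gt0.
rewrite /angle; apply: (@continuous_comp _ _ _ (fun u => (l i j u ^+ 2 + l i k u ^+ 2 - l j k u ^+ 2)
  / (2 * l i j u * l i k u)) acos);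
  last exact: continuous_acos (angle_cos_bounds ij ik jk r0).
apply: cvgM (cvgB (cvgD (sq _ (lc i j) u) (sq _ (lc i k) u)) (sq _ (lc j k) u)) _.
apply: cvgV (cvgM (cvgM (cvg_cst (2 : R)) (lc i j u)) (lc i k u)).
by rewrite !mulf_neq0 ?lt0r_neq0 ?edge_length_gt0.
Qed.
End ContinuousAngle.

Lemma continuous_sum (R : realType) (T : topologicalType) (I : Type) (r : seq I)
    (P : pred I) (f : I -> T -> R) : (forall i, P i -> continuous (f i)) ->
  continuous (fun x => \sum_(i <- r | P i) f i x).
Proof. by apply: continuous_big; exact: add_continuous. Qed.

(** * Zeros of the curvature field *)

Section ConstantCurvature.
Variables (R : realType) (n : nat) (T : triangulation n.+1).
Variables (Phi : {set 'I_n.+1} -> R) (alpha : R).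
Hypothesis hPhi : weight_function T Phi.

Let metric (u : 'rV[R]_n.+1) (i : 'I_n.+1) : R := expR (u ord0 i).

Lemma continuous_curvature i : continuous (fun u => curvature T Phi (metric u) i).
Proof.
have sum_c : continuous (fun u => \sum_(j < n.+1)
    \sum_(k < n.+1 | (j < k)%N && ([set i; j; k] \in faces T))
      angle Phi (metric u) i j k).
  apply: continuous_sum => j _; apply: continuous_sum => k /andP[_].
  rewrite -mem_triples => /(triple_acute hPhi) [ij ik jk].
  exact: continuous_angle.
by move=> u; exact: (cvgB (cvg_cst (2 * pi : R)) (sum_c u)).
Qed.

(** The [alpha]-curvature is constant exactly when the curvature is proportional to these
    weights. *)
Definition weight (u : 'rV[R]_n.+1) (i : 'I_n.+1) : R :=
  metric u i `^ alpha / \sum_j metric u j `^ alpha.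

Lemma sum_powR_gt0 u : 0 < \sum_j metric u j `^ alpha.
Proof.
rewrite (bigD1 ord0) //= ltr_wpDr ?powR_gt0 ?expR_gt0 //.
by apply: sumr_ge0 => j _; exact: powR_ge0.
Qed.

Lemma sum_weight u : \sum_i weight u i = 1.
Proof. by rewrite -mulr_suml divff // lt0r_neq0 // sum_powR_gt0. Qed.

Lemma continuous_weight i : continuous (fun u => weight u i).
Proof.
have pc j : continuous (fun u => metric u j `^ alpha).
  rewrite /metric; under eq_fun do rewrite -expRM.
  move=> u.
  apply: (@continuous_comp _ _ _ (fun u : 'rV[R]_n.+1 => u ord0 j * alpha) expR).
    exact: (cvgM (@coord_continuous R _ _ ord0 j u) (cvg_cst alpha)).
  exact: continuous_expR.
move=> u; apply: (cvgM (pc i u)); apply: cvgV; first exact: lt0r_neq0 (sum_powR_gt0 u).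
by apply: (@continuous_sum _ _ _ _ _ (fun j u => metric u j `^ alpha)) => j _; exact: pc.
Qed.

(** There are finitely many [I], so the negative quantities all stay below some [- eta]; with [M]
    triples, [e] is taken as [eta / (M + 1)]. *)
Lemma small_angle_defect :
    (forall I : {set 'I_n.+1}, I != finset.set0 -> I != [set: 'I_n.+1] ->
       - (\sum_(p in Lk T I) (pi - Phi p.1))
       + 2 * pi * (euler_char (subcomplex T I))%:~R < 0) ->
  exists e, [/\ 0 < e, 0 <= e <= pi &
    forall I : {set 'I_n.+1}, I != finset.set0 -> I != [set: 'I_n.+1] ->
       - (\sum_(p in Lk T I) (pi - Phi p.1))
       + 2 * pi * (euler_char (subcomplex T I))%:~R + e * #|triples T|%:R < 0].
Proof.
set bound := fun J : {set 'I_n.+1} => - (\sum_(p in Lk T J) (pi - Phi p.1))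
       + 2 * pi * (euler_char (subcomplex T J))%:~R.
rewrite -/(bound _) => hI.
pose proper (J : {set 'I_n.+1}) := (J != finset.set0) && (J != [set: 'I_n.+1]).
have [eta [eta0 eta1 bound_le]] : exists eta : R, [/\ 0 < eta, eta <= 1 &
    forall J, proper J -> bound J <= - eta].
  (* The minimum is capped at 1, which keeps [e] below [pi]. *)
  exists (\big[Order.min/1]_(J | proper J) - bound J); split.
  - apply/bigmin_gtP; split=> // J /andP[h1 h2]; rewrite oppr_gt0; exact: hI.
  - exact: bigmin_le_id.
  - by move=> J hJ; rewrite lerNr; exact: bigmin_le_cond.
have : 0 <= #|triples T|%:R :> R by exact: ler0n.
move: (#|triples T|%:R : R) => M M0.
have pi2 : 2 <= pi :> R := pi_ge2 R.
have M1 : 0 < M + 1 by lra.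
have e1 : eta / (M + 1) <= 1 by rewrite ler_pdivrMr //; lra.
have e0 : 0 < eta / (M + 1) by rewrite divr_gt0.
exists (eta / (M + 1)); split; [by []|by apply/andP; split; lra|].
move=> J h1 h2; rewrite -/(bound J).
have eM : eta / (M + 1) * M < eta by rewrite mulrAC ltr_pdivrMr // ltr_pM2l //; lra.
have : bound J <= - eta by apply: bound_le; rewrite /proper h1.
lra.
Qed.

Lemma exists_constant_curvature (S : R) : 0 <= S ->
    (forall r, circle_packing_metric r -> \sum_i curvature T Phi r i = S) ->
    (forall I : {set 'I_n.+1}, I != finset.set0 -> I != [set: 'I_n.+1] ->
       - (\sum_(p in Lk T I) (pi - Phi p.1))
       + 2 * pi * (euler_char (subcomplex T I))%:~R < 0) ->
  exists u, forall i, curvature T Phi (metric u) i = S * weight u i.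
Proof.
move=> S0 total hI.
have shift_le (a b c : R) : a + (1 - c) <= b -> a <= c + b by lra.
have metric_gt0 u : circle_packing_metric (metric u) by move=> i; exact: expR_gt0.
have [e [e0 epi eP]] := small_angle_defect hI.
have pi0 : 0 <= pi :> R := pi_ge0 R.
have cose : cos e < 1.
  have /andP[_ e1] := epi.
  by rewrite -cos0 ltr_cos ?in_itv /= ?lexx // epi.
have cose' := cos_geN1 e.
have [d [d0 d1 de]] : exists d : R, [/\ 0 < d, d <= 1 & 6 * d < 1 - cos e].
  (* Dividing by 7 rather than 6 makes the inequality strict, and [cos e >= -1] gives [d <= 1]. *)
  by exists ((1 - cos e) / 7); split; lra.
have d01 : 0 < d <= 1 by rewrite d0.
have lnd : ln d <= 0 by exact: ln_le0.
have [L L0 L2] : exists2 L : R, 0 < L & 2 * L / n.+1%:R = 1 - ln d.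
  (* The gap [2 L / (n + 1)] has to exceed [- ln d], so that radii across it have ratio at most [d];
     the summand 1 makes [L] positive. *)
  exists (n.+1%:R * (1 - ln d) / 2); last by field.
  by rewrite divr_gt0 // mulr_gt0 //; lra.
pose G i u := curvature T Phi (metric u) i - S * weight u i.
have Gc i : continuous (G i).
  have Wc : continuous (fun u => S * weight u i).
    by move=> u; exact: (cvgM (cvg_cst S) (@continuous_weight i u)).
  by move=> u; exact: (cvgB (@continuous_curvature i u) (Wc u)).
have [u uP] := cube_complementarity L0 Gc; exists u.
have sumG : \sum_i G i u = 0.
  by rewrite sumrB total // -mulr_sumr sum_weight mulr1 subrr.
suff G0 : forall i, G i u = 0 by move=> i; apply/eqP; rewrite -subr_eq0; apply/eqP/G0.
have no_mix i0 i1 : G i0 u < 0 -> 0 < G i1 u -> False.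
  move=> neg pos.
  have [_ [_ /(_ neg) uL]] := uP i0; have [_ [/(_ pos) uNL _]] := uP i1.
  have [J [J0 JT Jlt Jgap]] := gap_set (u := fun i => u ord0 i) L0 uNL uL.
  have small i j : i \in J -> j \notin J -> metric u i <= d * metric u j.
    move=> iJ jJ; have := Jgap i j iJ jJ; rewrite L2 => h.
    have -> : d * metric u j = expR (ln d + u ord0 j).
      by rewrite expRD lnK // posrE.
    by rewrite ler_expR; exact: shift_le h.
  have le := sum_curvature_le hPhi (metric_gt0 u) d01 epi de small.
  have : \sum_(i in J) G i u < 0.
    rewrite sumrB.
    (* The subtracted terms [S * weight u i] are nonnegative, so dropping them only raises the
       sum. *)
    apply: le_lt_trans (_ : _ <= \sum_(i in J) curvature T Phi (metric u) i) _.
      rewrite gerBl; apply: sumr_ge0 => i _; rewrite mulr_ge0 // divr_ge0 ?powR_ge0 //.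
      exact: ltW (sum_powR_gt0 u).
    exact: le_lt_trans le (eP J J0 JT).
  (* On the other hand, [G i u < 0] would force [u] to attain [L] at [i], which does not happen on
     [J]. *)
  rewrite ltNge; apply/negP; rewrite negbK; apply: sumr_ge0 => i iJ.
  rewrite leNgt; apply/negP => Gi.
  have [_ [_ /(_ Gi) ui]] := uP i; have := Jlt i iJ; rewrite ui ltxx.
  by [].
clearbody G; move=> i; apply/eqP; apply: contraT => ne; exfalso.
(* Without mixed signs, the terms of this zero sum all vanish. *)
have [neg|pos|z] := ltrgtP (G i u) 0; last by rewrite z eqxx in ne.
- have all_le j : 0 <= - G j u by rewrite oppr_ge0 leNgt; apply/negP => /(no_mix _ _ neg).
  have sumNG : \sum_j - G j u = 0 by rewrite sumrN sumG oppr0.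
  have /(_ i isT)/eqP : forall j, true -> - G j u = 0 by exact: psumr_eq0P.
  by rewrite oppr_eq0 (negPf ne).
have all_ge j : 0 <= G j u by rewrite leNgt; apply/negP => h; apply: (no_mix _ _ h pos).
have /(_ i isT)/eqP : forall j, true -> G j u = 0 by exact: psumr_eq0P.
by rewrite (negPf ne).
Qed.

Lemma exists_constant_alpha_curvature
    (hr : exists r : 'I_n.+1 -> R, circle_packing_metric r /\
            forall i, 0 <= alpha_curvature T Phi r alpha i)
    (hI : forall I : {set 'I_n.+1}, I != finset.set0 -> I != [set: 'I_n.+1] ->
            - (\sum_(p in Lk T I) (pi - Phi p.1))
            + 2 * pi * (euler_char (subcomplex T I))%:~R < 0) :
  exists rstar : 'I_n.+1 -> R, circle_packing_metric rstar /\
    exists c : R, 0 <= c /\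
      forall i, alpha_curvature T Phi rstar alpha i = c.
Proof.
have [r [r0 Rr]] := hr; pose S := \sum_i curvature T Phi r i.
have S0 : 0 <= S.
  apply: sumr_ge0 => i _; have := Rr i.
  by rewrite /alpha_curvature pmulr_lge0 // invr_gt0 powR_gt0.
have [|u uP] := exists_constant_curvature S0 _ hI.
  (* By Gauss-Bonnet, every metric has the total curvature of the given one. *)
  by move=> r' r'0; rewrite /S !(total_curvature hPhi).
exists (metric u); split; first by move=> i; exact: expR_gt0.
exists (S / \sum_j metric u j `^ alpha); split.
  by rewrite divr_ge0 // ltW // sum_powR_gt0.
move=> i; rewrite /alpha_curvature uP /weight mulrCA mulrAC divff ?mul1r //.
by rewrite lt0r_neq0 // powR_gt0 // expR_gt0.
Qed.
End ConstantCurvature.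

End Existence.

Theorem theorem1p7 (R : realType) (N : nat) (T : triangulation N)
    (Phi : {set 'I_N} -> R) (hPhi : weight_function T Phi) (alpha : R)
    (hr : exists r : 'I_N -> R, circle_packing_metric r /\
            forall i : 'I_N, 0 <= alpha_curvature T Phi r alpha i)
    (hI : forall I : {set 'I_N}, I != set0 -> I != [set: 'I_N] ->
            - (\sum_(p in Lk T I) (pi - Phi p.1))
            + 2 * pi * (euler_char (subcomplex T I))%:~R < 0) :
  exists rstar : 'I_N -> R, circle_packing_metric rstar /\
    exists c : R, 0 <= c /\
      forall i : 'I_N, alpha_curvature T Phi rstar alpha i = c.
Proof.
case: N T Phi hPhi hr hI => [|n] T Phi hPhi hr hI.
  (* Without vertices, all claims about them hold vacuously. *)
  by exists (fun=> 1); split=> [[]//|]; exists 0; split=> // -[].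
exact: Existence.exists_constant_alpha_curvature hPhi hr hI.
Qed.
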